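(* Let $G=(V,E)$ be an undirected graph with vertices $V=\{1,\dots,p\}$ and with minimum fill-in $1$, and let $\delta>-1$. Let $G^e=(V,E^e)$ denote the graph $G$ with one additional edge $e$, i.e. $E^e=E\cup\{e\}$, such that $G^e$ is chordal. Let $d$ denote the number of triangles formed by the edge $e$ and two other edges in $G^e$. Then $$ I_{G}(\delta,\mathbb{I}_p) = \pi^{-1/2}\,\frac{\Gamma\big(\delta+\frac12(d+ 2)\big)}{\Gamma\big(\delta+\frac12(d+3)\big)} \, I_{G^e}(\delta,\mathbb{I}_p). $$
   Context: $\mathbb{S}^p_{\succ0}$ is the cone of real symmetric positive definite $p\times p$ matrices. For an undirected graph $G=(V,E)$ on $V=\{1,\dots,p\}$, $\mathbb{S}^p_{\succ0}(G)=\{M\in\mathbb{S}^p_{\succ0}\mid M_{ij}=0\text{ for all distinct } i,j \text{ with }(i,j)\notin E\}$. For $D\in\mathbb{S}^p_{\succ0}$, $$I_G(\delta,D)=\int_{\mathbb{S}^p_{\succ0}(G)}|K|^{\delta}\exp(-\mathrm{tr}(KD))\,dK,\qquad dK=\prod_{i=1}^p dk_{ii}\prod_{i<j,\,(i,j)\in E}dk_{ij},$$ with $|K|=\det K$. $\mathbb{I}_p$ is the $p\times p$ identity matrix. A graph has minimum fill-in $1$ if it is not chordal but becomes chordal after the addition of one suitable edge. *)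

(* Defs.v *)
From HB Require Import structures.
From mathcomp Require Import all_boot all_order all_algebra.
From mathcomp Require Import all_classical all_reals all_analysis.

Set Implicit Arguments.
Unset Strict Implicit.
Unset Printing Implicit Defensive.

Import Order.TTheory GRing.Theory Num.Theory.
Import numFieldNormedType.Exports.

Local Open Scope classical_set_scope.
Local Open Scope ring_scope.

(* Lebesgue measure on R^n, with points of R^n as n-tuples: the product of the
   one-dimensional Lebesgue measure with Lebesgue measure on R^(n-1), carried
   to tuples along (x, t) |-> x :: t; in dimension 0, the unit point mass. *)
Fixpoint lebesgue_tuple (R : realType) (n : nat) :
    set (n.-tuple (measurableTypeR R)) -> \bar R :=
  match n with
  | 0 => \d_ [tuple]
  | m.+1 => pushforward (@lebesgue_measure R \x @lebesgue_tuple R m)%E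
              (fun xt => [tuple of xt.1 :: xt.2])
  end.

Lemma measurable_cons_pair (R : realType) (n : nat) :
  measurable_fun [set: measurableTypeR R * n.-tuple (measurableTypeR R)]
    (fun xt => [tuple of xt.1 :: xt.2]).
Proof. exact: measurable_cons. Qed.


Lemma lebesgue_tuple_sigma_finite_measure (R : realType) (n : nat) :
  { nu : {sigma_finite_measure set (n.-tuple (measurableTypeR R)) -> \bar R} |
    nu = @lebesgue_tuple R n :> (set _ -> \bar R) }.
Proof.
elim: n => [|n [mu mumE]] /=; first by exists \d_ [tuple].
rewrite -mumE.
pose c (xt : measurableTypeR R * n.-tuple (measurableTypeR R)) :=
  [tuple of xt.1 :: xt.2].
have mc : measurable_fun setT c by exact: measurable_cons_pair.
pose m : {measure set (measurableTypeR R * n.-tuple (measurableTypeR R)) -> \bar R} :=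
  (@lebesgue_measure R \x mu)%E.
have p0 : pushforward m c set0 = 0%E by rewrite /pushforward preimage_set0 measure0.
have mpre A : measurable A -> measurable (c @^-1` A).
  by move=> mA; rewrite -[X in measurable X]setTI; exact: mc.
have pge0 A : (0 <= pushforward m c A)%E by exact: measure_ge0.
have padd : semi_sigma_additive (pushforward m c).
  move=> F mF tF mUF; rewrite /pushforward preimage_bigcup.
  apply: measure_semi_sigma_additive.
  - by move=> i; exact: mpre.
  - apply/trivIsetP => /= i j _ _ ij; rewrite -preimage_setI.
    by move/trivIsetP : tF => /(_ _ _ _ _ ij) ->//; rewrite preimage_set0.
  - by rewrite -preimage_bigcup; exact: mpre.
have psf : sigma_finite setT (pushforward m c).
  have [H HT Hfin] : sigma_finite setT m.
    have /sigma_finiteP[F [TF ndF Foo]] := sigma_finiteT (@lebesgue_measure R).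
    have /sigma_finiteP[G [TG ndG Goo]] := sigma_finiteT mu.
    exists (fun k => F k `*` G k).
      rewrite -setXTT TF TG predeqE => -[x y]; split.
        move=> [/= [k _ Fkx] [l _ Gly]]; exists (maxn k l) => //; split.
        - by move: x Fkx; exact/subsetPset/ndF/leq_maxl.
        - by move: y Gly; exact/subsetPset/ndG/leq_maxr.
      by move=> [k _ []/= ? ?]; split; exists k.
    move=> k; have [? ?] := Foo k; have [? ?] := Goo k.
    split; first exact: measurableX.
    by rewrite /m/= product_measure1E// lte_mul_pinfty// ge0_fin_numE.
  pose u (t : n.+1.-tuple (measurableTypeR R)) := (thead t, [tuple of behead t]).
  have mu' : measurable_fun setT u.
    apply/measurable_fun_pairP; split; last exact: measurable_behead.
    exact: measurable_tnth.
  have uc : cancel c u by case=> x t; rewrite /u /c theadE /=; congr pair; apply/val_inj.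
  exists (fun k => u @^-1` H k).
    by rewrite -preimage_bigcup -HT preimage_setT.
  move=> k; have [mH Hoo] := Hfin k; split.
    by rewrite -[X in measurable X]setTI; exact: mu'.
  rewrite /pushforward -comp_preimage.
  by rewrite (_ : u \o c = id) //; apply/funext => x; exact: uc.
rewrite -[pushforward _ _]/(pushforward m c).
have [q qE] : { q | q = pushforward m c } by exists (pushforward m c).
rewrite -{}qE in p0 pge0 padd psf *.
pose nu : {measure set _ -> \bar R} :=
  HB.pack q (isMeasure.Build _ _ _ q p0 pge0 padd).
pose nu' : {sigma_finite_measure set _ -> \bar R} :=
  HB.pack q nu (Measure_isSigmaFinite.Build _ _ _ nu psf).
by exists nu'.
Qed.

Lemma lebesgue_tuple_set0 (R : realType) (n : nat) :
  @lebesgue_tuple R n set0 = 0%E.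
Proof.
by case: (lebesgue_tuple_sigma_finite_measure R n) => nu <-; rewrite measure0.
Qed.

Lemma lebesgue_tuple_ge0 (R : realType) (n : nat) (A : set _) :
  (0 <= @lebesgue_tuple R n A)%E.
Proof.
by case: (lebesgue_tuple_sigma_finite_measure R n) => nu <-; exact: measure_ge0.
Qed.

Lemma lebesgue_tuple_semi_sigma_additive (R : realType) (n : nat) :
  semi_sigma_additive (@lebesgue_tuple R n).
Proof.
case: (lebesgue_tuple_sigma_finite_measure R n) => nu <-.
exact: measure_semi_sigma_additive.
Qed.

Lemma lebesgue_tuple_sigma_finite (R : realType) (n : nat) :
  sigma_finite setT (@lebesgue_tuple R n).
Proof.
by case: (lebesgue_tuple_sigma_finite_measure R n) => nu <-; exact: sigma_finiteT.
Qed.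

HB.instance Definition _ (R : realType) (n : nat) :=
  isMeasure.Build _ _ _ (@lebesgue_tuple R n) (lebesgue_tuple_set0 R n)
    (@lebesgue_tuple_ge0 R n) (@lebesgue_tuple_semi_sigma_additive R n).

HB.instance Definition _ (R : realType) (n : nat) :=
  Measure_isSigmaFinite.Build _ _ _ (@lebesgue_tuple R n)
    (@lebesgue_tuple_sigma_finite R n).

(* Euler's integral; the intended value for 0 < x, where it converges. *)
Definition Gamma (R : realType) (x : R) : R :=
  \int[lebesgue_measure]_(t in `]0, +oo[) (t `^ (x - 1) * expR (- t)).

Definition posdefmx (R : realType) (p : nat) (M : 'M[R]_p) : Prop :=
  M^T = M /\ forall v : 'cV[R]_p, v != 0 -> 0 < (v^T *m M *m v) 0 0.

(* Graphs on {1, .., p} are symmetric irreflexive relations on 'I_p. *)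

Definition posdef_cone (R : realType) (p : nat) (E : rel 'I_p) : set 'M[R]_p :=
  [set M | posdefmx M /\ forall i j, i != j -> ~~ E i j -> M i j = 0].

(* Positions of the coordinates of dK: the diagonal, and the edges with i < j. *)
Definition free_entries (p : nat) (E : rel 'I_p) : seq ('I_p * 'I_p) :=
  [seq ij : 'I_p * 'I_p <- enum {: 'I_p * 'I_p} |
     (ij.1 == ij.2) || ((ij.1 < ij.2)%N && E ij.1 ij.2)].

(* The symmetric matrix with free entries k. At a position absent from
   free_entries E, index is out of range and nth returns 0. *)
Definition mx_of_entries (R : realType) (p : nat) (E : rel 'I_p)
    (k : (size (free_entries E)).-tuple R) : 'M[R]_p :=
  \matrix_(i, j)
    nth 0 k (index (if (i <= j)%N then (i, j) else (j, i)) (free_entries E)).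

(* Extended-real valued; the integrand is nonnegative on the cone. *)
Definition wishart_integral (R : realType) (p : nat) (E : rel 'I_p)
    (delta : R) (D : 'M[R]_p) : \bar R :=
  (\int[@lebesgue_tuple R (size (free_entries E))]_(k in
       [set k | posdef_cone E (mx_of_entries k)])
     (\det (mx_of_entries k) `^ delta
        * expR (- \tr (mx_of_entries k *m D)))%:E)%E.

Definition chordal (p : nat) (E : rel 'I_p) : Prop :=
  forall c : seq 'I_p, (3 < size c)%N -> ucycle E c ->
    exists x y, [/\ x \in c, y \in c, E x y, y != next c x & x != next c y].

Definition add_edge (p : nat) (E : rel 'I_p) (a b : 'I_p) : rel 'I_p :=
  fun i j => [|| E i j, (i == a) && (j == b) | (i == b) && (j == a)].

Definition min_fill_in_one (p : nat) (E : rel 'I_p) : Prop :=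
  ~ chordal E /\
  exists a b, [/\ a != b, ~~ E a b & chordal (add_edge E a b)].

Definition triangles_through (p : nat) (E : rel 'I_p) (a b : 'I_p) :
    {set {set 'I_p}} :=
  [set T : {set 'I_p} | [&& #|T| == 3%N, a \in T, b \in T &
     [forall x in T, forall y in T, (x != y) ==> E x y]]].

(* Main.v *)
Require Import Defs.
From mathcomp Require Import all_boot all_order all_algebra.
From mathcomp Require Import all_classical all_reals all_analysis.
From mathcomp Require Import measurable_realfun ring lra.

(* Eliminate the vertices other than a and b one at a time, each simplicial
   in the part of G^e that remains, by a Schur complement. Let M_S(s) be the
   integral over the entries of K supported on the remaining vertex set S, the
   entry at (a, b) being held at s; then I_G is M_V(0) and I_{G^e} is the
   integral of M_V over s.
   Eliminating a vertex v translates the remaining entries, and the only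
   non-edge of G between two neighbours of v is ab, so M_S is a multiple of
   M_{S - v} unless v is adjacent to both a and b, in which case s is shifted
   by a product of two independent Gaussian variables and integrated over them.
   For S = {a, b}, M_S is a multiple of h_delta, where
     h_beta(s) = int_0^oo k^beta exp(- k - s^2 / k) dk,
   and the Gaussian shift maps h_beta to a multiple of h_(beta + 1/2). Hence M_V
   is a multiple of h_(delta + d/2), by a constant that is common to I_G and I_{G^e}
   and need not be computed (nor be shown finite), and
     h_beta(0) = Gamma(beta + 1),  int h_beta = sqrt(pi) Gamma(beta + 3/2). *)

Set Implicit Arguments.
Unset Strict Implicit.
Unset Printing Implicit Defensive.

(** * Simplicial vertices of chordal graphs *)

Section chordal_graphs.
Variables (p : nat) (E : rel 'I_p).
Hypotheses (symE : symmetric E) (irrE : irreflexive E).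

Lemma next_cat_cons (c1 c2 : seq 'I_p) y z :
  uniq (c1 ++ y :: z :: c2) -> next (c1 ++ y :: z :: c2) y = z.
Proof.
rewrite cat_uniq => /and3P[_ /hasPn/(_ y)]; rewrite mem_head => /(_ isT) /= yc1 _.
rewrite next_nth mem_cat mem_head orbT.
case: c1 yc1 => [|u c1] /= yc1; first by rewrite eqxx.
rewrite inE negb_or in yc1; case/andP: yc1 => yu yc1.
rewrite eq_sym (negPf yu) index_cat (negPf yc1) /= eqxx addn0.
by rewrite nth_cat ltnNge leqnSn subSnn.
Qed.

Lemma next_last (c : seq 'I_p) x : uniq (x :: c) -> next (x :: c) (last x c) = x.
Proof.
move=> uc; rewrite next_nth mem_last.
by rewrite index_last// nth_default.
Qed.

(** A chord of the cycle formed by [x] and the path cannot end at [x], whose only neighbours on the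
    cycle are [s] and [t]; so it joins two vertices of the path and shortcuts it. Induction on the
    length leaves a single edge. *)
Lemma chordal_chord (x s t : 'I_p) (q : seq 'I_p) : chordal E ->
  E x s -> E x t -> s != t ->
  path E s q -> last s q = t -> uniq (x :: s :: q) ->
  (forall u, u \in q -> u != t -> ~~ E x u) -> E s t.
Proof.
move=> chE xs xt st; have [n] := ubnP (size q); elim: n q => // n IH q.
rewrite ltnS => sq pq lq uq nq.
have [sq1|sq1] := leqP (size q) 1.
  case: q sq1 pq lq {sq uq nq} => [|u [|//]] _ /=.
    by move=> _ /eqP; rewrite (negPf st).
  by rewrite andbT => + <-.
pose c := x :: s :: q.
have [||y [z [yc zc Eyz yz zy]]] := chE c; first by [].
  by rewrite /ucycle uq andbT /= xs rcons_path pq lq symE xt.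
have nextx : next c x = s by rewrite /c /= eqxx.
have nextt : next c t = x by rewrite -lq; exact: (@next_last (s :: q) x).
have Exz w : w \in c -> E x w -> w = s \/ w = t.
  rewrite !inE => /or3P[/eqP->|/eqP->|wq]; first by rewrite irrE.
    by left.
  by case: (eqVneq w t) => [->|/(nq _ wq)/negPf->//]; right.
have {Exz nextx nextt} [yx zx] : y != x /\ z != x.
  split; apply/eqP => yx; rewrite yx in yc zc Eyz yz zy.
    by case: (Exz _ zc Eyz) => zE; rewrite zE ?nextx ?nextt eqxx in yz zy.
  rewrite symE in Eyz.
  by case: (Exz _ yc Eyz) => yE; rewrite yE ?nextx ?nextt eqxx in yz zy.
have [{}yc {}zc] : y \in s :: q /\ z \in s :: q.
  by move: yc zc; rewrite /c !(in_cons x) (negPf yx) (negPf zx).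
(* A chord [u v] shortcuts the path. *)
have key q1 q2 q3 u v : E u v -> v != next c u ->
    s :: q = q1 ++ u :: q2 ++ v :: q3 -> E s t.
  move=> Euv vu defq.
  have q20 : 0 < size q2.
    case: q2 defq => //= defq; move: vu.
    rewrite /c defq -cat_cons next_cat_cons ?eqxx//.
    by rewrite /= -defq.
  case: q1 defq => [|s1 q1] [? defq]; subst.
    apply: (IH (v :: q3)).
    - by apply: leq_trans sq; rewrite size_cat -[X in X < _]add0n ltn_add2r.
    - by move: pq; rewrite cat_path /= Euv => /and3P[_ _ ->].
    - by rewrite last_cat.
    - by apply: subseq_uniq uq; rewrite /= !eqxx; exact: suffix_subseq.
    - by move=> w wq; apply: nq; rewrite mem_cat wq orbT.
  apply: (IH (q1 ++ u :: v :: q3)).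
  - apply: leq_trans sq; rewrite !size_cat /= size_cat /= !addnS !ltnS ltn_add2l.
    by rewrite -[X in X < _]add0n ltn_add2r.
  - by move: pq; rewrite !cat_path /= cat_path /= Euv => /and5P[-> -> _ _ ->].
  - by rewrite !last_cat /= last_cat.
  - apply: subseq_uniq uq; rewrite -!cat_cons; apply: cat_subseq => //.
    by rewrite -cat1s -[X in subseq _ X]cat1s cat_subseq// suffix_subseq.
  - move=> w wq; apply: nq; move: wq; rewrite !(mem_cat, inE).
    by case/or4P => ->; rewrite ?orbT.
have [q1 [r defq]] : exists q1 r, s :: q = q1 ++ y :: r.
  by case: (splitPr yc) => q1 r; exists q1, r.
move: zc; rewrite defq mem_cat in_cons => /or3P[zq|/eqP zy'|zr].
- case: (splitPr zq) defq => q2 q3; rewrite -catA /= => defq.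
  by apply: (key _ _ _ _ _ _ zy defq); rewrite symE.
- by rewrite zy' irrE in Eyz.
- by case: (splitPr zr) defq => q2 q3; exact: key yz.
Qed.

Definition clique (Q : {set 'I_p}) :=
  forall i j, i \in Q -> j \in Q -> i != j -> E i j.

Definition simplicial (S : {set 'I_p}) v :=
  forall i j, i \in S -> j \in S -> E v i -> E v j -> i != j -> E i j.

(* A connected component [C] of the non-neighbours of [x] in [S] has a clique
   [Sep] as boundary, and a vertex of [C] that is simplicial in [C :|: Sep] is
   simplicial in [S]. *)
Lemma exists_simplicial (S Q : {set 'I_p}) : chordal E ->
  Q \proper S -> clique Q -> exists2 v, v \in S :\: Q & simplicial S v.
Proof.
move=> chE; have [n] := ubnP #|S|; elim: n S Q => // n IH S Q.
rewrite ltnS => Sn QS cQ.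
pose universal x := [forall y in S, (x != y) ==> E x y].
have universalP x y : universal x -> y \in S -> x != y -> E x y.
  by move=> /forall_inP/[apply]/implyP.
have [/forall_inP SU|] := boolP [forall x in S, universal x].
  have /properP[_ [v vS vQ]] := QS.
  exists v; first by rewrite inE vQ.
  by move=> i j iS jS _ _ ij; apply: universalP => //; exact: SU.
move=> /forall_inPn[x0 x0S x0U].
(* The vertex obtained is moreover not adjacent to [x]; a suitable choice of [x] will then keep it
   out of [Q]. *)
have nonuniversal x : x \in S -> ~~ universal x ->
    exists2 v, v \in S & [/\ v != x, ~~ E x v & simplicial S v].
  move=> xS /forall_inPn[v0 v0S]; rewrite negb_imply => /andP[xv0 nEv0].
  pose W := [set y in S | (y != x) && ~~ E x y].
  have v0W : v0 \in W by rewrite inE v0S eq_sym xv0.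
  pose e := [rel u v | [&& u \in W, v \in W & E u v]].
  have syme : symmetric e by move=> u v; rewrite /= symE andbCA.
  pose C := [set y in W | connect e v0 y].
  have CW : {subset C <= W} by move=> y; rewrite inE => /andP[].
  have v0C : v0 \in C by rewrite inE v0W connect0.
  pose Sep := [set s in S | E x s && [exists c in C, E c s]].
  (* Two boundary vertices are joined by a path whose interior lies in [C], hence consists of
     non-neighbours of [x]. Once shortened to a simple path it fits [chordal_chord]. *)
  have cSep : clique Sep.
    move=> s t; rewrite !inE => /and3P[sS xs /exists_inP[cs csC Ecs]].
    move=> /and3P[tS xt /exists_inP[ct ctC Ect]] st.
    have : connect e cs ct.
      move: csC ctC; rewrite !inE => /andP[_ v0cs] /andP[_].
      by apply: connect_trans; rewrite (sym_connect_sym syme).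
    move=> /connectP[l pl ctE].
    have lW : {subset l <= W}.
      elim: l {ctE} cs {csC Ecs} pl => //= u l IHl c /andP[/and3P[_ uW _] /IHl lW] w.
      by rewrite inE => /predU1P[->//|/lW].
    have El : path E cs l by apply: sub_path pl => u v /and3P[].
    have pq : path E s (cs :: rcons l t).
      by rewrite /= symE Ecs rcons_path El -ctE Ect.
    have : last s (cs :: rcons l t) = t by rewrite /= last_rcons.
    case/shortenP : pq => q pq uq sub lq.
    have qW u : u \in q -> u != t -> u \in W.
      move/sub; rewrite inE mem_rcons inE => /or3P[/eqP->|/eqP->|/lW//].
        by rewrite CW.
      by rewrite eqxx.
    apply: (chordal_chord chE xs xt st pq lq).
      rewrite cons_uniq uq andbT inE negb_or.
      have [xs'|_] := eqVneq; first by rewrite -xs' irrE in xs.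
      apply/negP => /qW; have [xt'|_] := eqVneq; first by rewrite -xt' irrE in xt.
      by move=> /(_ isT); rewrite inE eqxx andbF.
    by move=> u /qW/[apply]; rewrite inE => /and3P[].
  have v0Sep : v0 \notin Sep by rewrite inE (negPf nEv0) andbF.
  have US : C :|: Sep \subset S.
    by apply/fintype.subsetP => u; rewrite !inE => /orP[/andP[/andP[]]//|/andP[]].
  (* The set is smaller because it misses [x]. With [Sep] as the clique to avoid, the vertex found
     lies in [C]. *)
  have [||//|v] := IH (C :|: Sep) Sep.
  - apply: leq_trans Sn; apply: proper_card; apply/properP; split=> //.
    by exists x => //; rewrite !inE eqxx irrE !andbF.
  - by apply/properP; split; [exact: finset.subsetUr|exists v0; rewrite // inE v0C].
  rewrite finset.in_setD finset.in_setU => /andP[vSep]; rewrite (negPf vSep) orbF => vC simv.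
  have := CW _ vC; rewrite inE => /and3P[vS vx nExv].
  (* Since [C] is a whole component, every neighbour of [v] in [S] lies in [C :|: Sep]. *)
  exists v => //; split=> // i j iS jS vi vj; apply: simv => //.
  + have [ix|ix] := eqVneq i x; first by rewrite symE -ix vi in nExv.
    have [xi|nxi] := boolP (E x i).
      by apply/setUP; right; rewrite inE iS xi; apply/exists_inP; exists v.
    have iW : i \in W by rewrite inE iS ix.
    apply/setUP; left; rewrite inE iW /=; move: (vC); rewrite inE => /andP[_ v0v].
    by apply: (connect_trans v0v); apply: connect1; rewrite /= iW CW.
  + have [jx|jx] := eqVneq j x; first by rewrite symE -jx vj in nExv.
    have [xj|nxj] := boolP (E x j).
      by apply/setUP; right; rewrite inE jS xj; apply/exists_inP; exists v.
    have jW : j \in W by rewrite inE jS jx.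
    apply/setUP; left; rewrite inE jW /=; move: (vC); rewrite inE => /andP[_ v0v].
    by apply: (connect_trans v0v); apply: connect1; rewrite /= jW CW.
(* If some [x] in [Q] is not universal, a vertex distinct from [x] and not adjacent to it is outside
   the clique [Q]. Otherwise all of [Q] is universal, and a vertex not adjacent to [x0] is not. *)
have [/exists_inP[x xQ xU]|QU] := boolP [exists x in Q, ~~ universal x].
  have [|v vS [vx nExv simv]] := nonuniversal x _ xU.
    exact: (fintype.subsetP (proper_sub QS)).
  exists v => //; rewrite inE vS andbT; apply/negP => vQ.
  by rewrite cQ// eq_sym in nExv.
have [v vS [vx nExv simv]] := nonuniversal _ x0S x0U.
exists v => //; rewrite inE vS andbT; apply/negP => vQ.
have vU : universal v.
  by move: QU; rewrite negb_exists_in => /forall_inP/(_ v vQ); rewrite negbK.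
by rewrite symE (universalP _ _ vU) in nExv.
Qed.

End chordal_graphs.

Import Order.TTheory GRing.Theory Num.Theory.
Import numFieldNormedType.Exports.

Local Open Scope classical_set_scope.
Local Open Scope ring_scope.

(** * Affine substitution on the real line *)

Section affine.
Variable R : realType.
Implicit Type f : R -> \bar R.
Notation mu := (@lebesgue_measure R).
Local Open Scope ereal_scope.

(** By uniqueness of Lebesgue measure: [a] times its image under [phi] gives each half-open interval
    its length. *)
Lemma ge0_integral_affine f (a c : R) : (0 < a)%R -> measurable_fun [set: R] f ->
  (forall x, 0 <= f x) ->
  \int[mu]_x f x = a%:E * \int[mu]_x f (a * x + c)%R.
Proof.
move=> a0 mf f0.
pose phi : measurableTypeR R -> measurableTypeR R := fun x => (a * x + c)%R.
have mphi : measurable_fun setT phi.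
  by apply: measurable_funD => //; apply: mulrl_measurable.
pose push := (pushforward mu phi : {measure set (measurableTypeR R) -> \bar R}).
pose nu := mscale (NngNum (ltW a0)) (push mphi).
have nuE : forall A, measurable A -> mu A = nu A.
  apply: lebesgue_measure_unique => _ [[x y] /= xy <-].
  rewrite /nu /mscale /= /pushforward.
  have -> : phi @^-1` `]x, y] = `]((x - c) / a)%R, ((y - c) / a)%R]%classic.
    apply/seteqP; split=> z /=; rewrite !in_itv /= /phi.
      by rewrite ltr_pdivrMr// ler_pdivlMr// mulrC ltrBlDr lerBrDr mulrC.
    by rewrite ltr_pdivrMr// ler_pdivlMr// ltrBlDr lerBrDr mulrC.
  rewrite !lebesgue_measure_itv /= !lte_fin ltr_pM2r ?invr_gt0// ltrD2r.
  case: ifPn => _; last by rewrite mule0.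
  rewrite -!EFinB -EFinM; congr EFin.
  by field; rewrite gt_eqF.
rewrite (eq_measure_integral nu); last by move=> A mA _; exact: nuE.
rewrite /nu ge0_integral_mscale//=.
by rewrite ge0_integral_pushforward.
Qed.

Lemma ge0_integral_translate f (c : R) : measurable_fun [set: R] f ->
  (forall x, 0 <= f x) -> \int[mu]_x f (x + c)%R = \int[mu]_x f x.
Proof.
move=> mf f0; rewrite [RHS](@ge0_integral_affine _ 1%R c)// mul1e.
by apply: eq_integral => x _; rewrite mul1r.
Qed.

End affine.

(** * Iterated integrals over lists of coordinates *)

Section iterated_integrals.
Variables (R : realType) (I : eqType).
Notation mu := (@lebesgue_measure R).
Local Open Scope ereal_scope.
Implicit Types (w : I -> R) (f g : (I -> R) -> \bar R) (s : seq I).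

Definition upd w i (t : R) : I -> R := fun j => if j == i then t else w j.

(** Points are functions on an index type, not tuples, so that variables can be permuted and split
    off without renumbering. Coordinates absent from [s] stay frozen at their value in [w]. *)
Fixpoint iter_integral s f w : \bar R :=
  if s is i :: s' then \int[mu]_t iter_integral s' f (upd w i t) else f w.

(* Measurability of a functional on [I -> R], tested along all measurable
   families of points; this avoids putting a sigma-algebra on [I -> R]. *)
Definition coord_measurable f := forall d (T : measurableType d) (g : T -> I -> R),
  (forall i, measurable_fun [set: T] (g ^~ i)) -> measurable_fun [set: T] (f \o g).

Lemma upd_measurable d (T : measurableType d) (g : T -> I -> R) (h : T -> R) i :
  (forall i, measurable_fun [set: T] (g ^~ i)) -> measurable_fun [set: T] h ->
  forall j, measurable_fun [set: T] (fun x => upd (g x) i (h x) j).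
Proof. by move=> mg mh j; rewrite /upd; case: eqP. Qed.

Lemma updC w i j t u : i != j -> upd (upd w i t) j u = upd (upd w j u) i t.
Proof.
move=> ij; apply/funext => k; rewrite /upd.
by case: eqP => // ->; rewrite eq_sym (negPf ij).
Qed.

Lemma upd_upd w i t u : upd (upd w i t) i u = upd w i u.
Proof. by apply/funext => k; rewrite /upd; case: eqP. Qed.

Lemma iter_integral_ge0 s f w : (forall w, 0 <= f w) -> 0 <= iter_integral s f w.
Proof.
by move=> f0; elim: s w => //= i s IH w; apply: integral_ge0 => x _.
Qed.

Lemma coord_measurable_iter s f : (forall w, 0 <= f w) -> coord_measurable f ->
  coord_measurable (iter_integral s f).
Proof.
move=> f0 mf; elim: s => //= i s IH d T g mg.
pose h (x : T * measurableTypeR R) := iter_integral s f (upd (g x.1) i x.2).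
apply: (@measurable_fun_fubini_tonelli_F _ _ _ _ _ mu h).
  apply: IH; apply: upd_measurable; last exact: measurable_snd.
  by move=> j; exact: (measurableT_comp (mg j) measurable_fst).
by move=> x; exact: iter_integral_ge0.
Qed.

Lemma measurable_upd f w i : coord_measurable f ->
  measurable_fun [set: R] (fun t => f (upd w i t)).
Proof.
move=> mf; apply: (mf _ _ (fun t : measurableTypeR R => upd w i t)).
by apply: (@upd_measurable _ _ (fun=> w) id).
Qed.

Lemma measurable_iter_upd s f w i : (forall w, 0 <= f w) -> coord_measurable f ->
  measurable_fun [set: R] (fun t => iter_integral s f (upd w i t)).
Proof.
move=> f0 mf; exact: (measurable_upd w i (coord_measurable_iter s f0 mf)).
Qed.

Lemma iter_integral_cat s1 s2 f :
  iter_integral (s1 ++ s2) f = iter_integral s1 (iter_integral s2 f).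
Proof.
apply/funext; elim: s1 => //= i s IH w.
by apply: eq_integral => x _; rewrite IH.
Qed.

Lemma iter_integral_eq s f g w :
  (forall w', (forall i, i \notin s -> w' i = w i) -> f w' = g w') ->
  iter_integral s f w = iter_integral s g w.
Proof.
elim: s w => [|i s IH] w /= fg; first by apply: fg.
apply: eq_integral => x _; apply: IH => w' ww'; apply: fg => j.
by rewrite inE negb_or => /andP[ji js]; rewrite ww'// /upd (negPf ji).
Qed.

Lemma iter_integral_agree (D : pred I) s f w w' :
  (forall w1 w2, {in D, w1 =1 w2} -> f w1 = f w2) ->
  (forall i, i \in D -> i \notin s -> w i = w' i) ->
  iter_integral s f w = iter_integral s f w'.
Proof.
move=> fD; elim: s w w' => [|i s IH] w w' ww' /=.
  by apply: fD => i iD; exact: ww'.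
apply: eq_integral => x _; apply: IH => j jD js; rewrite /upd.
by case: eqVneq => // ji; apply: ww'; rewrite // inE negb_or ji.
Qed.

Lemma iter_integral_swap1 i s f w : (forall w, 0 <= f w) -> coord_measurable f ->
  \int[mu]_t iter_integral s f (upd w i t) =
  iter_integral s (fun w => \int[mu]_t f (upd w i t)) w.
Proof.
move=> f0 mf; elim: s w => //= j s IH w.
(* For [i = j] the later update overrides the earlier one, and both sides become the same double
   integral. Otherwise this is Tonelli. *)
case: (eqVneq i j) IH => [-> IH|ij IH].
  transitivity (\int[mu]_t \int[mu]_u iter_integral s f (upd w j u)).
    by apply: eq_integral => t _; apply: eq_integral => u _; rewrite upd_upd.
  apply: eq_integral => t _; rewrite -IH; apply: eq_integral => u _.
  by rewrite upd_upd.
pose h (x : measurableTypeR R * measurableTypeR R) :=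
  iter_integral s f (upd (upd w i x.1) j x.2).
have mh : measurable_fun [set: _] h.
  apply: coord_measurable_iter => //; apply: upd_measurable.
    apply: (@upd_measurable _ _ (fun=> w)) => //; exact: measurable_fst.
  exact: measurable_snd.
rewrite (@fubini_tonelli _ _ _ _ _ mu mu h)//; last first.
  by move=> x; exact: iter_integral_ge0.
apply: eq_integral => u _; rewrite -IH; apply: eq_integral => t _.
by rewrite /h/= updC.
Qed.

Lemma iter_integral_catC s1 s2 f : (forall w, 0 <= f w) -> coord_measurable f ->
  iter_integral (s1 ++ s2) f = iter_integral (s2 ++ s1) f.
Proof.
move=> f0 mf; rewrite !iter_integral_cat.
elim: s1 => //= i s IH; apply/funext => w.
under eq_integral do rewrite IH.
by rewrite iter_integral_swap1//; [move=> w'; exact: iter_integral_ge0|exact: coord_measurable_iter].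
Qed.

(** Tonelli for exchanges of adjacent blocks, which generate all permutations. *)
Lemma iter_integral_perm s1 s2 f : (forall w, 0 <= f w) -> coord_measurable f ->
  perm_eq s1 s2 -> iter_integral s1 f = iter_integral s2 f.
Proof.
move=> f0 mf p12; pose P s := iter_integral s f = iter_integral s1 f.
suff : P s2 by [].
apply: (@catCA_perm_ind _ P) p12 _ => // r1 r2 r3; rewrite /P => <-.
rewrite !catA [LHS]iter_integral_cat [RHS]iter_integral_cat.
apply: iter_integral_catC; first by move=> w; exact: iter_integral_ge0.
exact: coord_measurable_iter.
Qed.

Lemma iter_integralZ s f w (c : \bar R) : 0 <= c ->
  (forall w, 0 <= f w) -> coord_measurable f ->
  iter_integral s (fun w => c * f w) w = c * iter_integral s f w.
Proof.
move=> c0 f0 mf; elim: s w => //= i s IH w.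
under eq_integral do rewrite IH.
by rewrite ge0_integralZl// => [|x _]; [exact: measurable_iter_upd|exact: iter_integral_ge0].
Qed.

Lemma iter_integral_translate s f w (c : I -> R) :
  (forall w, 0 <= f w) -> coord_measurable f ->
  iter_integral s (fun w => f (fun i => w i + c i)%R) w =
  iter_integral s f (fun i => w i + c i)%R.
Proof.
move=> f0 mf; elim: s w => //= i s IH w.
rewrite -[RHS](@ge0_integral_translate _ _ (c i)).
- apply: eq_integral => x _; rewrite IH; congr iter_integral.
  by apply/funext => j; rewrite /upd; case: eqP => // ->.
- exact: measurable_iter_upd.
- by move=> x; exact: iter_integral_ge0.
Qed.

Definition assign s (k : seq R) w : I -> R :=
  fun i => if i \in s then (nth 0 k (index i s))%R else w i.

(** Passes from tuples to families of coordinates. The recursive definition of the product measure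
    is unfolded with one use of Tonelli per coordinate. *)
Lemma integral_lebesgue_tuple s f w : uniq s ->
  (forall w, 0 <= f w) -> coord_measurable f ->
  \int[@lebesgue_tuple R (size s)]_k f (assign s k w) = iter_integral s f w.
Proof.
move=> us f0 mf.
have ma n (r : seq I) (v : I -> R) j :
    measurable_fun [set: n.-tuple (measurableTypeR R)] (fun k => assign r k v j).
  rewrite /assign; case: (j \in r) => //.
  have [jn|nj] := ltnP (index j r) n.
    rewrite (_ : (fun _ => _) = (fun k : n.-tuple _ => tnth k (Ordinal jn))).
      exact: measurable_tnth.
    by apply/funext => k; rewrite (tnth_nth 0%R).
  rewrite (_ : (fun _ => _) = cst 0%R)//.
  by apply/funext => k; rewrite nth_default// size_tuple.
elim: s us w => [_|i s IH /= /andP[is_ us]] w.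
  rewrite /= integral_dirac//; last by apply: mf => j; exact: (ma 0%N).
  by rewrite /dirac indicT mul1e; congr f; apply/funext.
pose c (xt : measurableTypeR R * (size s).-tuple (measurableTypeR R)) :=
  [tuple of xt.1 :: xt.2].
have mc : measurable_fun setT c by exact: measurable_cons_pair.
have mF : measurable_fun [set: (size s).+1.-tuple (measurableTypeR R)]
    (fun k => f (assign (i :: s) k w)).
  by apply: mf => j; exact: ma.
rewrite (@ge0_integral_pushforward _ _ _ _ _ c)//.
rewrite preimage_setT; have mFc := measurableT_comp mF mc.
rewrite fubini_tonelli1//; last by move=> x; exact: f0.
apply: eq_integral => x _; rewrite -IH//; apply: eq_integral => k _ /=.
congr f; apply/funext => j; rewrite /assign /upd inE /=.
by have [->|ji] := eqVneq j i; rewrite ?(negPf is_) ?eqxx.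

Qed.

End iterated_integrals.

(** Reduced to the measurability of a power, according to the sign of [x]. *)
Lemma measurable_invr (R : realType) : measurable_fun [set: R] (fun x : R => x^-1)%R.
Proof.
rewrite (_ : (fun _ => _) = (fun x : R => if (0 < x)%R then (x `^ (-1))%R
    else if (x < 0)%R then (- ((- x) `^ (-1)))%R else 0%R)); last first.
  apply/funext => x; case: (ltrgtP 0%R x) => [x0|x0|<-]; last by rewrite invr0.
    by rewrite powR_inv1// ltW.
  by rewrite powR_inv1 ?oppr_ge0 1?ltW// invrN opprK.
apply: measurable_fun_ifT.
- exact: measurable_fun_ltr.
- exact: measurable_powR.
- apply: measurable_fun_ifT => //; first exact: measurable_fun_ltr.
  apply: measurable_funN; apply: (measurableT_comp (@measurable_powR _ _)).
  exact: oppr_measurable.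
Qed.

Ltac measurability := lazymatch goal with
| |- measurable_fun _ (fun x => EFin (@?f x)) =>
    apply/measurable_EFinP; measurability
| |- measurable_fun _ (fun x => Order.lt (@?f x) (@?g x)) =>
    apply: measurable_fun_ltr; measurability
| |- measurable_fun _ (fun x => GRing.opp (@?f x)) =>
    apply: measurable_funN; measurability
| |- measurable_fun _ (fun x => GRing.add (@?f x) (@?g x)) =>
    apply: measurable_funD; measurability
| |- measurable_fun _ (fun x => GRing.mul (@?f x) (@?g x)) =>
    apply: measurable_funM; measurability
| |- measurable_fun _ (fun x => GRing.exp (@?f x) _) =>
    apply: measurable_funX; measurability
| |- measurable_fun _ (fun x => GRing.inv (@?f x)) =>
    apply: (measurableT_comp (@measurable_invr _)); measurability
| |- measurable_fun _ (fun x => expR (@?f x)) =>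
    apply: (measurableT_comp (@measurable_expR _)); measurability
| |- measurable_fun _ (fun x => powR (@?f x) _) =>
    apply: (measurableT_comp (@measurable_powR _ _)); measurability
| |- _ => first [exact: measurable_cst | exact: measurable_id
    | exact: measurable_fst | exact: measurable_snd
    | exact: oppr_measurable | exact: measurable_invr
    | exact: measurable_expR | exact: measurable_powR
    | exact: measurable_fun_ltr
    | apply: measurable_fun_ifT; measurability | idtac]
end.

(** * The kernels h_b and their Gaussian shifts *)

Section kernels.
Variable R : realType.
Notation mu := (@lebesgue_measure R).
Local Open Scope ereal_scope.

Lemma ge0_integral_gauss_affine (c m : R) : (0 < c)%R ->
  \int[mu]_x (expR (- (c * (x - m) ^+ 2)))%:E = (Num.sqrt (pi / c))%:E.
Proof.
move=> c0.
have mg : measurable_fun [set: R] (fun x : R => (expR (- (c * (x - m) ^+ 2)))%:E).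
  by measurability.
rewrite (@ge0_integral_affine _ _ (Num.sqrt c)^-1 m) ?invr_gt0 ?sqrtr_gt0//.
transitivity (((Num.sqrt c)^-1)%:E * \int[mu]_x (gauss_fun x)%:E).
  congr (_ * _); apply: eq_integral => x _.
  rewrite /gauss_fun addrK exprMn exprVn sqr_sqrtr ?ltW//.
  by rewrite mulrA divff ?mul1r// gt_eqF.
rewrite integralT_gauss -EFinM; congr EFin.
by rewrite mulrC sqrtrM ?pi_ge0// sqrtrV// ltW.
Qed.

(* The function h_b of the header. The cut-off at [0 < k] is needed because
   [k `^ b] is [1], not [0], for [k < 0]. *)
Definition offdiag_density (b s : R) : \bar R :=
  \int[mu]_k (if (0 < k)%R then k `^ b * expR (- k) * expR (- (s ^+ 2 / k)) else 0)%:E.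

Lemma measurable_offdiag_integrand (b : R) :
  measurable_fun [set: R * R] (fun x : R * R =>
    (if (0 < x.2)%R then x.2 `^ b * expR (- x.2) * expR (- (x.1 ^+ 2 / x.2)) else 0)%:E).
Proof.
by measurability. Qed.

Lemma offdiag_density_ge0 b s : 0 <= offdiag_density b s.
Proof.
apply: integral_ge0 => k _; rewrite lee_fin; case: ifP => // _.
by rewrite !mulr_ge0 ?powR_ge0 ?expR_ge0.
Qed.

Lemma measurable_offdiag_density b : measurable_fun [set: R] (offdiag_density b).
Proof.
apply: (@measurable_fun_fubini_tonelli_F _ _ _ _ _ mu _ (measurable_offdiag_integrand b)).
move=> [s k] /=; rewrite lee_fin; case: ifP => // _.
by rewrite !mulr_ge0 ?powR_ge0 ?expR_ge0.
Qed.



(** With h_b written as an integral over [k], the integral over [z] is Gaussian and turns s^2 / k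
    into s^2 / (k + y^2). In the variables u = k + y^2 and t = y / sqrt(u) the integrand is a
    product, and the factor in [u] is that of h_(b + 1/2). *)
Lemma offdiag_density_mixing (b : R) : exists2 c : \bar R, 0 <= c & forall s : R,
  \int[mu]_y \int[mu]_z ((expR (- y ^+ 2) * expR (- z ^+ 2))%:E *
     offdiag_density b (s - y * z)) = c * offdiag_density (b + 2^-1) s.
Proof.
(* A Beta integral, the factor in [t]. It is infinite for small [b], hence a constant in the
   extended reals. *)
pose J := \int[mu]_t (if (t ^+ 2 < 1)%R then (1 - t ^+ 2) `^ (b + 2^-1) else 0)%:E.
have J0 : 0 <= J.
  by apply: integral_ge0 => t _; rewrite lee_fin; case: ifP => // _; rewrite powR_ge0.
exists ((Num.sqrt pi)%:E * J) => [|s]; first by rewrite mule_ge0// lee_fin sqrtr_ge0.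
(* [g1] is the integrand with the variable [k] of h_b made explicit; [g2] is what integration over
   [z] leaves of it, in the variable u = k + y^2. *)
pose g1 (y z k : R) := (if 0 < k then expR (- y ^+ 2) * expR (- z ^+ 2) *
   (k `^ b * expR (- k) * expR (- ((s - y * z) ^+ 2 / k))) else 0)%R.
pose g2 (y u : R) := (if y ^+ 2 < u then
   Num.sqrt pi * u `^ (- 2^-1) * expR (- u) * expR (- (s ^+ 2 / u)) *
   (u - y ^+ 2) `^ (b + 2^-1) else 0)%R.
have g10 y z k : 0 <= (g1 y z k)%:E.
  by rewrite lee_fin /g1; case: ifP => // _; rewrite !mulr_ge0 ?expR_ge0 ?powR_ge0.
have g20 y u : 0 <= (g2 y u)%:E.
  rewrite lee_fin /g2; case: ifP => // _.
  by rewrite !mulr_ge0 ?expR_ge0 ?powR_ge0 ?sqrtr_ge0.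
have mg2 : measurable_fun [set: R * R] (fun x : R * R => (g2 x.1 x.2)%:E).
  by rewrite /g2; measurability.
transitivity (\int[mu]_y \int[mu]_z \int[mu]_k (g1 y z k)%:E).
  apply: eq_integral => y _; apply: eq_integral => z _.
  rewrite /offdiag_density -ge0_integralZl//.
  - apply: eq_integral => k _; rewrite -EFinM /g1; congr EFin.
    by case: ifP; rewrite ?mulr0.
  - by measurability.
  - by move=> k _; rewrite lee_fin; case: ifP => // _; rewrite !mulr_ge0 ?expR_ge0 ?powR_ge0.
transitivity (\int[mu]_y \int[mu]_u (g2 y u)%:E).
  apply: eq_integral => y _.
  rewrite (@fubini_tonelli _ _ _ _ _ mu mu (fun x => (g1 y x.1 x.2)%:E))//=; last first.
    by rewrite /g1; measurability.
  rewrite -[RHS](@ge0_integral_translate _ _ (y ^+ 2))//; last first.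
    by rewrite /g2; measurability.
  apply: eq_integral => k _; rewrite /g2 ltrDr.
  case: ltP => k0; last first.
    by rewrite integral0_eq// => z _; rewrite /g1 ltNge k0.
  have ky0 : (0 < k + y ^+ 2)%R by rewrite ltr_wpDr ?sqr_ge0.
  have kyN0 := gt_eqF ky0; have kN0 := gt_eqF k0.
  (* The factors free of [z] once the square in [z] is completed around s y / (k + y^2). *)
  pose K := (expR (- y ^+ 2) * k `^ b * expR (- k) * expR (- (s ^+ 2 / (k + y ^+ 2))))%R.
  transitivity (\int[mu]_z (K%:E * (expR (- ((1 + y ^+ 2 / k) *
      (z - s * y / (k + y ^+ 2)) ^+ 2)))%:E)).
    apply: eq_integral => z _; rewrite -EFinM /g1 k0 /K; congr EFin.
    rewrite [LHS](_ : _ = (k `^ b * expR (- y ^+ 2 - z ^+ 2 - k - (s - y * z) ^+ 2 / k))%R); last first.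
      by rewrite !expRD; ring.
    rewrite [RHS](_ : _ = (k `^ b * expR (- y ^+ 2 - k - s ^+ 2 / (k + y ^+ 2) -
       ((1 + y ^+ 2 / k) * (z - s * y / (k + y ^+ 2)) ^+ 2)))%R); last first.
      by rewrite !expRD; ring.
    by congr (_ * expR _)%R; field; rewrite kN0 kyN0.
  rewrite ge0_integralZl//; last 2 first.
  - by measurability.
  - by rewrite lee_fin !mulr_ge0 ?expR_ge0 ?powR_ge0.
  rewrite ge0_integral_gauss_affine ?ltr_pwDl ?divr_ge0 ?sqr_ge0 ?ltW// -EFinM.
  congr EFin; rewrite addrK /K.
  (* The mass of the Gaussian in [z]. Its factor k^(1/2) is what raises the exponent by one half. *)
  have -> : (Num.sqrt (pi / (1 + y ^+ 2 / k)) =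
      Num.sqrt pi * (k + y ^+ 2) `^ (- 2^-1) * k `^ 2^-1 :> R)%R.
    rewrite powRN !powR12_sqrt ?ltW// -sqrtrV ?ltW// -!sqrtrM ?mulr_ge0 ?invr_ge0 ?pi_ge0 ?ltW//.
    by congr Num.sqrt; field; rewrite kN0 kyN0.
  rewrite powRD ?kN0 ?implybT// opprD expRD; ring.
rewrite (@fubini_tonelli _ _ _ _ _ mu mu (fun x => (g2 x.1 x.2)%:E))//=.
rewrite -ge0_integralZl//; last 3 first.
- by measurability.
- by move=> k _; rewrite lee_fin; case: ifP => // _; rewrite !mulr_ge0 ?expR_ge0 ?powR_ge0.
- by rewrite mule_ge0// lee_fin sqrtr_ge0.
apply: eq_integral => u _; case: ltP => u0; last first.
  rewrite mule0 integral0_eq// => y _; rewrite /g2 ltNge.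
  by rewrite (le_trans u0) ?sqr_ge0.
(* The substitution y = sqrt(u) t makes the domain y^2 < u independent of [u]; its Jacobian cancels
   u^(-1/2). *)
rewrite (@ge0_integral_affine _ _ (Num.sqrt u) 0) ?sqrtr_gt0//; last first.
  by rewrite /g2; measurability.
pose K := (Num.sqrt pi * u `^ (- 2^-1) * expR (- u) * expR (- (s ^+ 2 / u)) * u `^ (b + 2^-1))%R.
transitivity ((Num.sqrt u)%:E * \int[mu]_t (K%:E *
    (if (t ^+ 2 < 1)%R then (1 - t ^+ 2) `^ (b + 2^-1) else 0)%:E)).
  congr (_ * _); apply: eq_integral => t _; rewrite -EFinM /g2 addr0; congr EFin.
  rewrite exprMn sqr_sqrtr ?ltW// gtr_pMr//; case: ifPn => t1; last by rewrite mulr0.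
  have -> : (u - u * t ^+ 2 = u * (1 - t ^+ 2))%R by ring.
  rewrite powRM ?ltW ?subr_gt0// /K; ring.
rewrite ge0_integralZl//; last 3 first.
- by measurability.
- by move=> t _; rewrite lee_fin; case: ifP => // _; rewrite powR_ge0.
- by rewrite lee_fin !mulr_ge0 ?expR_ge0 ?powR_ge0 ?sqrtr_ge0.
rewrite -/J muleA -EFinM muleAC -EFinM; congr (_%:E * _).
rewrite /K powRN powR12_sqrt ?ltW//; field.
by rewrite gt_eqF// sqrtr_gt0.
Qed.

End kernels.

(** * Schur complements and the Wishart density of a block *)

Section positive_definite.
Variable (R : realType) (p : nat).
Implicit Types (M A : 'M[R]_p) (S : {set 'I_p}) (w : 'I_p * 'I_p -> R).

Lemma posdefmx_congr A M : A \in unitmx ->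
  posdefmx (A *m M *m A^T) <-> posdefmx M.
Proof.
have sub (B N : 'M[R]_p) : B \in unitmx -> posdefmx N -> posdefmx (B *m N *m B^T).
  move=> uB [sN pN]; split=> [|v v0]; first by rewrite !trmx_mul trmxK sN mulmxA.
  have -> : v^T *m (B *m N *m B^T) *m v = (B^T *m v)^T *m N *m (B^T *m v).
    by rewrite trmx_mul trmxK !mulmxA.
  apply: pN; apply: contra_neq v0 => Bv0.
  have uBT : B^T \in unitmx by rewrite unitmx_tr.
  by rewrite -[v]mul1mx -(mulVmx uBT) -mulmxA Bv0 mulmx0.
move=> uA; split; last exact: sub.
have uAi : invmx A \in unitmx by rewrite unitmx_inv.
move=> /(sub _ _ uAi); rewrite -mulmxA !mulmxA mulVmx// mul1mx -mulmxA.
by rewrite -trmx_mul mulVmx// trmx1 mulmx1.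
Qed.

Lemma posdefmx_diag_gt0 M i : posdefmx M -> 0 < M i i.
Proof.
move=> [_ /(_ (delta_mx i 0))].
rewrite trmx_delta -rowE -colE !mxE; apply.
by apply/eqP => /matrixP/(_ i 0); rewrite !mxE !eqxx /= => /eqP; rewrite oner_eq0.
Qed.

Lemma posdefmx1 : posdefmx (1%:M : 'M[R]_p).
Proof.
split=> [|v v0]; first exact: trmx1.
rewrite mulmx1 mxE; under eq_bigr do rewrite mxE -expr2.
rewrite lt_def sumr_ge0 ?andbT => [|i _]; last exact: sqr_ge0.
apply: contra_neq v0 => /psumr_eq0P v0; apply/colP => i; rewrite mxE.
by apply/eqP; rewrite -sqrf_eq0 v0// => j _; exact: sqr_ge0.
Qed.

(** The one position that stores both symmetric entries, on the side of the diagonal used by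
    [free_entries]. *)
Definition opair (i j : 'I_p) := if (i <= j)%N then (i, j) else (j, i).

Lemma opairC i j : opair i j = opair j i.
Proof. by rewrite /opair; case: ltngtP => // /val_inj->. Qed.

Lemma opair_id i : opair i i = (i, i).
Proof. by rewrite /opair leqnn. Qed.

Lemma opair_inj i : injective (opair i).
Proof. by move=> j k; rewrite /opair; do 2!case: ifP => _; case=> *; subst. Qed.

Definition entry w i j := w (opair i j).

Lemma entryC w i j : entry w i j = entry w j i.
Proof. by rewrite /entry opairC. Qed.

(* The block of a symmetric matrix on [S], completed by the identity so that the
   size stays [p] when vertices are eliminated. *)
Definition blockmx S w : 'M[R]_p :=
  \matrix_(i, j) if (i \in S) && (j \in S) then entry w i j else (i == j)%:R.

Definition schur v w : 'I_p * 'I_p -> R :=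
  fun ij => w ij - entry w v ij.1 * entry w v ij.2 / entry w v v.

Lemma entry_schur v w i j :
  entry (schur v w) i j = entry w i j - entry w v i * entry w v j / entry w v v.
Proof.
rewrite {1}/entry /schur -/(entry w i j); congr (_ - _ / _).
by rewrite /opair; case: ifP => // _ /=; exact: mulrC.
Qed.

Lemma blockmx0 w : blockmx finset.set0 w = 1%:M.
Proof. by apply/matrixP => i j; rewrite !mxE inE. Qed.

(** The factor of one Cholesky step with pivot [v]. *)
Definition pivot_mx S v w : 'M[R]_p := \matrix_(i, j)
  if j == v then blockmx S w i v / Num.sqrt (entry w v v) else (i == j)%:R.

(** Row and column [v] of the completed Schur complement are those of the identity. In the product
    they yield the rank-one matrix which the Schur complement had subtracted. *)
Lemma blockmx_schur S v w : v \in S -> 0 < entry w v v ->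
  blockmx S w = pivot_mx S v w *m blockmx (S :\ v) (schur v w) *m (pivot_mx S v w)^T.
Proof.
move=> vS k0; set A := pivot_mx S v w; set N := blockmx (S :\ v) _.
have Nv j : N v j = (v == j)%:R by rewrite /N mxE !in_setD1 eqxx.
have Nv' j : N j v = (j == v)%:R by rewrite /N mxE !in_setD1 eqxx andbF.
have AN i j : (A *m N) i j = if j == v then A i v else N i j *+ (i != v) + A i v * N v j.
  rewrite mxE (bigD1 v)//= addrC.
  have [->|jv] := eqVneq j v.
    rewrite Nv eqxx mulr1 big1 ?add0r// => l lv.
    by rewrite Nv' (negPf lv) mulr0.
  congr (_ + _); have [->|iv] := eqVneq i v.
    rewrite big1// => l lv; rewrite /A mxE (negPf lv) eq_sym (negPf lv) mul0r//.
  rewrite (bigD1 i)//= /A mxE (negPf iv) eqxx mul1r big1 ?addr0// => l /andP[lv li].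
  by rewrite mxE (negPf lv) eq_sym (negPf li) mul0r.
have sq : Num.sqrt (entry w v v) ^+ 2 = entry w v v by rewrite sqr_sqrtr// ltW.
have kN : Num.sqrt (entry w v v) != 0 by rewrite gt_eqF// sqrtr_gt0.
have Bv i : blockmx S w i v = if i \in S then entry w v i else 0.
  rewrite mxE vS andbT; case: ifP => iS; first by rewrite entryC.
  by have [iv|] := eqVneq i v; first by rewrite iv vS in iS.
apply/matrixP => i j; rewrite [RHS]mxE (bigD1 v)//= AN eqxx.
rewrite (eq_bigr (fun l => (N i l *+ (i != v)) * (j == l)%:R)) => [|l lv]; last first.
  have -> : A^T l j = (j == l)%:R by rewrite mxE /A mxE (negPf lv).
  by rewrite AN (negPf lv) Nv [v == l]eq_sym (negPf lv) mulr0 addr0.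
(* Away from column [v] the factor is the identity, so these terms reproduce the Schur complement
   alone. *)
rewrite (_ : \sum_(l | _) _ = N i j *+ ((i != v) && (j != v))); last first.
  have [->|jv] := eqVneq j v.
    rewrite andbF big1// => l lv; by rewrite [v == l]eq_sym (negPf lv) mulr0.
  rewrite andbT (bigD1 j)//= eqxx mulr1 big1 ?addr0// => l /andP[_ lj].
  by rewrite [j == l]eq_sym (negPf lj) mulr0.
have Av l : A l v = (if l \in S then entry w v l else 0) / Num.sqrt (entry w v v).
  by rewrite /A mxE eqxx Bv.
have -> : A^T v j = A j v by rewrite mxE.
rewrite !Av -[X in _ = X + _](_ : (if i \in S then entry w v i else 0) *
  (if j \in S then entry w v j else 0) / entry w v v = _); last first.
  by rewrite -[X in _ / X = _]sq; field.
rewrite [LHS]mxE /N mxE !in_setD1 entry_schur.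
have kN0 : entry w v v != 0 by rewrite gt_eqF.
have [iv|iv] := eqVneq i v; have [jv|jv] := eqVneq j v; rewrite /= ?iv ?jv ?vS ?andbT.
- by rewrite mulr0n addr0 mulfK.
- rewrite mulr0n addr0 mulrAC divff// mul1r.
  by case: (j \in S); rewrite //= eq_sym (negPf jv).
- rewrite andbF mulr0n addr0 mulfK// entryC.
  by case: (i \in S); rewrite //= (negPf iv).
- rewrite mulr1n.
  case: (i \in S); case: (j \in S); rewrite /= ?mul0r ?mulr0 ?mul0r ?add0r//.
  by rewrite [RHS]addrC subrK.
Qed.

Lemma det_pivot_mx S v w : v \in S -> 0 < entry w v v ->
  \det (pivot_mx S v w) = Num.sqrt (entry w v v).
Proof.
move=> vS k0; rewrite (expand_det_row _ v) (bigD1 v)//= big1 ?addr0 => [|j jv]; last first.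
  by rewrite mxE (negPf jv) eq_sym (negPf jv) mul0r.
rewrite /cofactor -signr_odd oddD addbb expr0 mul1r.
rewrite [X in \det X](_ : _ = 1%:M) ?det1 ?mulr1.
  rewrite !mxE eqxx vS /= -{1}[entry w v v]sqr_sqrtr ?ltW// expr2 mulfK//.
  by rewrite gt_eqF// sqrtr_gt0.
apply/matrixP => i j; rewrite !mxE eq_sym (negPf (neq_lift _ _)).
by rewrite (inj_eq lift_inj).
Qed.

(** A positive pivot makes [pivot_mx] invertible, and congruence by an invertible matrix preserves
    positive definiteness. Conversely the pivot is a diagonal entry, hence positive. *)
Lemma posdefmx_blockmx_schur S v w : v \in S ->
  posdefmx (blockmx S w) <->
  0 < entry w v v /\ posdefmx (blockmx (S :\ v) (schur v w)).
Proof.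
move=> vS.
have uA : 0 < entry w v v -> pivot_mx S v w \in unitmx.
  by move=> k0; rewrite unitmxE det_pivot_mx// unitfE gt_eqF// sqrtr_gt0.
split=> [pK|[k0 pK]].
  have k0 : 0 < entry w v v by have := posdefmx_diag_gt0 v pK; rewrite mxE vS.
  split=> //; move: pK; rewrite (blockmx_schur vS k0).
  by move=> /(posdefmx_congr _ (uA k0)).
by rewrite (blockmx_schur vS k0); apply/posdefmx_congr => //; exact: uA.
Qed.

Lemma det_blockmx_schur S v w : v \in S -> 0 < entry w v v ->
  \det (blockmx S w) = entry w v v * \det (blockmx (S :\ v) (schur v w)).
Proof.
move=> vS k0; rewrite (blockmx_schur vS k0) !det_mulmx det_tr det_pivot_mx//.
by rewrite mulrAC -expr2 sqr_sqrtr// ltW.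
Qed.

(** The determinant is the product of the successive pivots. *)
Lemma det_posdef_blockmx_gt0 S w : posdefmx (blockmx S w) -> 0 < \det (blockmx S w).
Proof.
have [n] := ubnP #|S|; elim: n S w => // n IH S w Sn.
have [->|[v vS]] := set_0Vmem S; first by rewrite blockmx0 det1.
move=> /(posdefmx_blockmx_schur _ vS)[k0 pK].
rewrite (det_blockmx_schur vS)// mulr_gt0// IH//.
by rewrite -ltnS (leq_trans _ Sn)// ltnS [X in (_ < X)%N](cardsD1 v) vS.
Qed.

(** The integrand for D the identity, extended by zero off the cone so that integrals run over whole
    lines. The trace is taken over [S] only, leaving out the ones that complete the block. *)
Definition block_density (delta : R) S w : R :=
  if `[< posdefmx (blockmx S w) >]
  then \det (blockmx S w) `^ delta * expR (- \sum_(i in S) entry w i i) else 0.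

Lemma block_density_ge0 delta S w : 0 <= block_density delta S w.
Proof. by rewrite /block_density; case: ifP => // _; rewrite mulr_ge0 ?powR_ge0 ?expR_ge0. Qed.

(** The determinant factors through the pivot, and each diagonal entry is that of the Schur
    complement plus the square of an entry of row [v] over the pivot: these squares make row [v]
    Gaussian. *)
Lemma block_density_schur delta S v w : v \in S ->
  block_density delta S w = if 0 < entry w v v then
    entry w v v `^ delta *
    expR (- (entry w v v + (\sum_(i in S :\ v) entry w v i ^+ 2) / entry w v v)) *
    block_density delta (S :\ v) (schur v w) else 0.
Proof.
move=> vS; rewrite /block_density; case: ltP => k0; last first.
  rewrite asboolF// => /(posdefmx_blockmx_schur _ vS)[].
  by rewrite ltNge k0.
have -> : `[< posdefmx (blockmx S w) >] = `[< posdefmx (blockmx (S :\ v) (schur v w)) >].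
  apply/asbool_equiv_eq; split; first by move=> /(posdefmx_blockmx_schur _ vS)[].
  by move=> pK; apply/(posdefmx_blockmx_schur _ vS).
case: asboolP => pK; last by rewrite mulr0.
rewrite (det_blockmx_schur vS)// powRM ?(ltW k0)//; last exact: ltW (det_posdef_blockmx_gt0 pK).
rewrite mulrACA -expRD; congr (_ * expR _).
rewrite -opprD (bigD1 v)//= -addrA; congr (- (_ + _)).
rewrite mulr_suml (eq_bigl (mem (S :\ v))) => [|i]; last by rewrite !inE andbC.
rewrite -big_split /=; apply: eq_bigr => i _.
by rewrite entry_schur -expr2 addrC subrK.
Qed.

(** Eliminating one vertex at a time reduces positive definiteness to the positivity of pivots, a
    measurable condition. *)
Lemma coord_measurable_block_density delta S :
  coord_measurable (fun w => (block_density delta S w)%:E).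
Proof.
have [n] := ubnP #|S|; elim: n S => // n IH S Sn d T g mg.
have [->|[v vS]] := set_0Vmem S.
  rewrite (_ : _ \o _ = cst 1%E)//; apply/funext => x /=.
  rewrite /block_density blockmx0 asboolT; last exact: posdefmx1.
  by rewrite det1 powR1 big_pred0 ?oppr0 ?expR0 ?mulr1// => i; rewrite inE.
rewrite (_ : _ \o _ = (fun x => (if 0 < entry (g x) v v then
  entry (g x) v v `^ delta *
  expR (- (entry (g x) v v + (\sum_(i in S :\ v) entry (g x) v i ^+ 2) / entry (g x) v v)) *
  block_density delta (S :\ v) (schur v (g x)) else 0)%:E)); last first.
  by apply/funext => x /=; rewrite (block_density_schur delta _ vS).
have mk i : measurable_fun [set: T] (fun x => entry (g x) v i) by exact: mg.
apply/measurable_EFinP/measurable_fun_ifT => //; first exact: measurable_fun_ltr.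
apply: measurable_funM.
  apply: measurable_funM; first exact: (measurableT_comp (@measurable_powR _ _)).
  apply: (measurableT_comp (@measurable_expR _)); apply: measurable_funN.
  apply: measurable_funD => //; apply: measurable_funM.
    under eq_fun do rewrite -big_enum.
    by apply: measurable_sum => i; apply: measurable_funX.
  exact: (measurableT_comp (@measurable_invr _)).
apply/measurable_EFinP; apply: (IH (S :\ v) _ _ _ (fun x => schur v (g x))).
  by rewrite -ltnS (leq_trans _ Sn)// ltnS [X in (_ < X)%N](cardsD1 v) vS.
move=> ij; apply: measurable_funB => //; apply: measurable_funM.
  exact: measurable_funM.
exact: (measurableT_comp (@measurable_invr _)).
Qed.

End positive_definite.

(** * Gaussian integration over the row of a pivot *)

Section scaled_mixing.
Variable R : realType.
Notation mu := (@lebesgue_measure R).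
Local Open Scope ereal_scope.

(** Dividing [y] and [z] by sqrt(k) reduces this to the unscaled case; the two Jacobians give the
    factor [k]. *)
Lemma offdiag_density_mixing_scaled (b : R) : exists2 c : \bar R, 0 <= c & forall k s : R,
  (0 < k)%R ->
  \int[mu]_y \int[mu]_z ((expR (- ((y ^+ 2 + z ^+ 2) / k)))%:E *
     offdiag_density b (s - y * z / k)) = k%:E * (c * offdiag_density (b + 2^-1) s).
Proof.
have [c c0 cE] := offdiag_density_mixing b; exists c => // k s k0.
pose F (x : R * R) := (expR (- ((x.1 ^+ 2 + x.2 ^+ 2) / k)))%:E *
  offdiag_density b (s - x.1 * x.2 / k).
have F0 x : 0 <= F x by rewrite mule_ge0// ?offdiag_density_ge0// lee_fin expR_ge0.
have mF : measurable_fun [set: R * R] F.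
  apply: emeasurable_funM; first by measurability.
  by apply: (measurableT_comp (@measurable_offdiag_density _ b)); measurability.
have sk0 : (0 < Num.sqrt k)%R by rewrite sqrtr_gt0.
have kk : (Num.sqrt k ^+ 2 = k)%R by rewrite sqr_sqrtr// ltW.
have kN0 : (k != 0)%R by rewrite gt_eqF.
transitivity (\int[mu]_y \int[mu]_z F (y, z)); first by [].
rewrite (@ge0_integral_affine _ _ _ 0%R sk0); last 2 first.
- exact: (@measurable_fun_fubini_tonelli_F _ _ _ _ _ mu _ mF).
- by move=> y; exact: integral_ge0.
transitivity ((Num.sqrt k)%:E * \int[mu]_y ((Num.sqrt k)%:E *
    \int[mu]_z ((expR (- y ^+ 2) * expR (- z ^+ 2))%:E * offdiag_density b (s - y * z)))).
  apply: (congr1 (mule _)); apply: eq_integral => y _.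
  rewrite [LHS](@ge0_integral_affine _ (fun z => F (Num.sqrt k * y + 0, z)%R) _ 0%R sk0); last 2 first.
  - exact: (measurableT_comp mF (pair1_measurable _)).
  - by move=> z; exact: F0.
  apply: (congr1 (mule _)); apply: eq_integral => z _; rewrite /F /= !addr0.
  have -> : (Num.sqrt k * y * (Num.sqrt k * z) / k = y * z)%R.
    by rewrite mulrACA -expr2 kk mulrAC divff// mul1r.
  have -> : (- (((Num.sqrt k * y) ^+ 2 + (Num.sqrt k * z) ^+ 2) / k) = - y ^+ 2 - z ^+ 2)%R.
    by rewrite !exprMn kk; field.
  by rewrite expRD.
pose G (x : R * R) := (expR (- x.1 ^+ 2) * expR (- x.2 ^+ 2))%:E *
  offdiag_density b (s - x.1 * x.2).
have G0 x : 0 <= G x.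
  by rewrite mule_ge0// ?offdiag_density_ge0// lee_fin mulr_ge0// expR_ge0.
have mG : measurable_fun [set: R * R] G.
  apply: emeasurable_funM; first by measurability.
  by apply: (measurableT_comp (@measurable_offdiag_density _ b)); measurability.
rewrite ge0_integralZl//; last 2 first.
- exact: (@measurable_fun_fubini_tonelli_F _ _ _ _ _ mu G).
- by move=> y _; apply: integral_ge0 => z _; rewrite mule_ge0// ?offdiag_density_ge0// lee_fin mulr_ge0 ?expR_ge0.
by rewrite muleA -EFinM -expr2 kk cE.
Qed.

End scaled_mixing.

Section gauss_iter.
Variables (R : realType) (p : nat) (v : 'I_p).
Notation mu := (@lebesgue_measure R).
Local Open Scope ereal_scope.
Implicit Type w : 'I_p * 'I_p -> R.

Lemma integral_gauss_scaled (k : R) : (0 < k)%R ->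
  \int[mu]_x (expR (- (x ^+ 2 / k)))%:E = ((pi * k) `^ (2^-1))%:E.
Proof.
move=> k0; rewrite powR12_sqrt ?mulr_ge0 ?pi_ge0 ?ltW//.
have kV0 : (0 < k^-1)%R by rewrite invr_gt0.
rewrite -[in RHS](invrK k) -(ge0_integral_gauss_affine 0 kV0).
by apply: eq_integral => x _; rewrite subr0 mulrC.
Qed.

Lemma measurable_entry d (T : measurableType d) (g : T -> 'I_p * 'I_p -> R) i j :
  (forall ij, measurable_fun [set: T] (g ^~ ij)) ->
  measurable_fun [set: T] (fun x => entry (g x) i j).
Proof. by move=> mg; exact: mg. Qed.

Lemma coord_measurable_expR_sumsq (l : seq 'I_p) (k : R) :
  coord_measurable (fun w : 'I_p * 'I_p -> R =>
    (expR (- ((\sum_(u <- l) entry w v u ^+ 2) / k)))%:E).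
Proof.
move=> d T g mg; apply/measurable_EFinP.
apply: (measurableT_comp (@measurable_expR _)); apply: measurable_funN.
apply: measurable_funM => //; apply: measurable_sum => u.
by apply: measurable_funX; exact: measurable_entry.
Qed.

(** The entries are independent Gaussian variables on which [q] does not depend, and each
    contributes (pi k)^(1/2). *)
Lemma iter_integral_gauss (k : R) (l : seq 'I_p) (q : ('I_p * 'I_p -> R) -> \bar R) w :
  (0 < k)%R -> uniq l -> (forall w, 0 <= q w) -> coord_measurable q ->
  (forall w u t, u \in l -> q (upd w (opair v u) t) = q w) ->
  iter_integral [seq opair v u | u <- l] (fun w =>
    (expR (- ((\sum_(u <- l) entry w v u ^+ 2) / k)))%:E * q w) w =
  (((pi * k) `^ (2^-1)) ^+ size l)%:E * q w.
Proof.
move=> k0; elim: l q w => [|u l IH] q w /=.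
  by move=> _ _ _ _; rewrite big_nil mul0r oppr0 expR0 ?expr0 !mul1e.
move=> /andP[ul uql] q0 mq qu; set r := ((pi * k) `^ (2^-1))%R in IH *.
have r0 : (0 <= r)%R by exact: powR_ge0.
transitivity (\int[mu]_t ((r ^+ size l)%:E * q w * (expR (- (t ^+ 2 / k)))%:E)).
  apply: eq_integral => t _.
  (* The factor of the outermost variable is constant for the inner integrals and is moved into [q]
     for the induction. *)
  pose q' w := (expR (- (entry w v u ^+ 2 / k)))%:E * q w.
  rewrite (_ : (fun w => _) = (fun w => (expR (- ((\sum_(u <- l) entry w v u ^+ 2) / k)))%:E * q' w)); last first.
    apply/funext => w'; rewrite muleA -EFinM -expRD; congr ((expR _)%:E * _).
    by rewrite big_cons mulrDl opprD addrC.
  rewrite IH//.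
  - rewrite /q' qu ?mem_head// /entry /upd eqxx.
    by rewrite [X in _ * X]muleC muleA.
  - by move=> w'; rewrite mule_ge0// lee_fin expR_ge0.
  - move=> d T g mg; apply: emeasurable_funM; last exact: mq.
    have := coord_measurable_expR_sumsq [:: u] k mg.
    by apply: eq_measurable_fun => x _ /=; rewrite big_seq1.
  - move=> w' u' t' u'l; rewrite /q' qu ?inE ?u'l ?orbT//.
    rewrite /entry /upd (inj_eq (@opair_inj _ v)); case: eqVneq => // uu'.
    by rewrite uu' u'l in ul.
rewrite ge0_integralZl//; last 2 first.
- by measurability.
- by rewrite mule_ge0// lee_fin exprn_ge0.
by rewrite integral_gauss_scaled// -/r muleC muleA -EFinM -exprS.
Qed.

End gauss_iter.

(** * Elimination of one simplicial vertex *)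

Section elimination.
Variables (R : realType) (p : nat) (E : rel 'I_p) (a b : 'I_p) (delta : R).
Hypotheses (symE : symmetric E) (irrE : irreflexive E).
Notation mu := (@lebesgue_measure R).
Implicit Types (S : {set 'I_p}) (w : 'I_p * 'I_p -> R).
Let Ee := add_edge E a b.

Lemma opair_eq (i j k l : 'I_p) : opair i j = opair k l ->
  (i = k /\ j = l) \/ (i = l /\ j = k).
Proof. by rewrite /opair; do 2!case: ifP => _; case=> *; subst; auto. Qed.

Definition block_entries S :=
  [seq ij <- free_entries E | (ij.1 \in S) && (ij.2 \in S)].

Definition nbrs S v := [set u in S | E v u].

Lemma mem_block_entries S i j : ((i, j) \in block_entries S) =
  [&& i \in S, j \in S & (i == j) || ((i < j)%N && E i j)].
Proof. by rewrite mem_filter mem_filter /= mem_enum andbT andbA. Qed.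

Lemma uniq_block_entries S : uniq (block_entries S).
Proof. by rewrite filter_uniq// filter_uniq// enum_uniq. Qed.

Lemma mem_star S v i j : v \in S ->
  ((i, j) \in [seq opair v u | u <- enum (nbrs S v)]) =
  [&& i \in S, j \in S, (i < j)%N, E i j & (i == v) || (j == v)].
Proof.
move=> vS; apply/mapP/idP => [[u]|].
  rewrite mem_enum inE => /andP[uS Evu]; rewrite /opair.
  have vu : v != u by apply: contraTneq Evu => ->; rewrite irrE.
  case: (leqP v u) => vu' /= -[-> ->]; rewrite vS uS eqxx ?orbT ?Evu ?andbT //=.
    by rewrite ltn_neqAle vu vu'.
  by rewrite vu' symE.
move=> /and5P[iS jS ij Eij] /orP[] /eqP ?; subst.
  by exists j; rewrite ?mem_enum ?inE ?jS// /opair ltnW.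
by exists i; rewrite ?mem_enum ?inE ?iS 1?symE// /opair leqNgt ij.
Qed.

(** Fixes the order of integration: the pivot outermost, then the edges at [v], and innermost the
    entries that the Schur complement moves. *)
Lemma block_entries_pivot S v : v \in S ->
  perm_eq (block_entries S)
    ((v, v) :: [seq opair v u | u <- enum (nbrs S v)] ++ block_entries (S :\ v)).
Proof.
move=> vS; apply: uniq_perm.
- exact: uniq_block_entries.
- rewrite cons_uniq mem_cat mem_star// mem_block_entries !in_setD1 eqxx ltnn.
  rewrite !andbF /= cat_uniq uniq_block_entries map_inj_uniq ?enum_uniq ?andbT /=; last exact: opair_inj.
  apply/hasPn => -[i j]; rewrite mem_block_entries !in_setD1 mem_star//.
  by move=> /and3P[/andP[/negPf-> _] /andP[/negPf-> _] _]; rewrite !andbF.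
move=> [i j]; rewrite in_cons mem_cat mem_star// !mem_block_entries !in_setD1.
rewrite xpair_eqE.
have [->|iv] := eqVneq i v; have [->|jv] := eqVneq j v; rewrite ?vS ?eqxx ?andbF ?orbF ?andbT //=.
by rewrite (negPf iv).
Qed.

(** Entries that are not integrated over keep these values: [s] for the pair [a], [b], and 0 for the
    other non-edges. *)
Definition pair_start (s : R) : 'I_p * 'I_p -> R := upd (fun=> 0) (opair a b) s.

(* M_S of the header. *)
Definition offdiag_marginal S (s : R) : \bar R :=
  iter_integral (block_entries S) (fun w => (block_density delta S w)%:E) (pair_start s).

Let Phi_ge0 S w : (0 <= (block_density delta S w)%:E)%E.
Proof. by rewrite lee_fin block_density_ge0. Qed.

Let mPhi S : coord_measurable (fun w => (block_density delta S w)%:E).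
Proof. exact: coord_measurable_block_density. Qed.

Lemma offdiag_marginal_ge0 S s : (0 <= offdiag_marginal S s)%E.
Proof. exact: iter_integral_ge0. Qed.

Lemma measurable_offdiag_marginal S : measurable_fun [set: R] (offdiag_marginal S).
Proof. exact: measurable_iter_upd. Qed.

Lemma pair_startE s i j : pair_start s (opair i j) =
  if opair i j == opair a b then s else 0.
Proof. by []. Qed.

Section pivot.
Variables (S : {set 'I_p}) (v : 'I_p).
Hypotheses (vS : v \in S) (va : v != a) (vb : v != b) (simv : simplicial Ee S v).
Let star := [seq opair v u | u <- enum (nbrs S v)].

Lemma opair_pivot_neq i : opair v i != opair a b.
Proof.
by apply/eqP => /opair_eq[][eqv _]; [move: va|move: vb]; rewrite eqv eqxx.
Qed.

Lemma notin_star i j : i \in S :\ v -> j \in S :\ v -> opair i j \notin star.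
Proof.
rewrite !in_setD1 => /andP[iv iS] /andP[jv jS].
apply/mapP => -[u _] /opair_eq[[iv' _]|[_ jv']].
  by rewrite iv' eqxx in iv.
by rewrite jv' eqxx in jv.
Qed.

Lemma pivot_notin_star : opair v v \notin star.
Proof.
apply/mapP => -[u]; rewrite mem_enum inE => /andP[_ Evu] /opair_inj uv.
by rewrite -uv irrE in Evu.
Qed.

(** The entry is frozen, and as [v] is neither [a] nor [b] it is not the one that holds [s]. *)
Lemma pivot_entry0 s k w i : i \notin nbrs S v -> i != v ->
  (forall ij, ij \notin star -> w ij = upd (pair_start s) (opair v v) k ij) ->
  entry w v i = 0.
Proof.
move=> iN iv ww; rewrite /entry ww; last first.
  by apply/mapP => -[u]; rewrite mem_enum => uN /opair_inj iu; rewrite iu uN in iN.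
by rewrite /upd (inj_eq (@opair_inj _ v)) (negPf iv) pair_startE (negPf (opair_pivot_neq i)).
Qed.

Lemma offdiag_marginal_reduce s k w :
  (forall ij, ij \notin star -> w ij = upd (pair_start s) (opair v v) k ij) ->
  iter_integral (block_entries (S :\ v)) (fun w => (block_density delta S w)%:E) w =
  ((if (0 < k)%R then k `^ delta * expR (- k) else 0)%:E *
   ((expR (- ((\sum_(u <- enum (nbrs S v)) entry w v u ^+ 2) / k)))%:E *
    offdiag_marginal (S :\ v) (s - entry w v a * entry w v b / k)))%E.
Proof.
move=> ww.
have kE : entry w v v = k by rewrite /entry ww ?pivot_notin_star// /upd eqxx.
pose C := (if 0 < k then k `^ delta * expR (- k) else 0) *
   expR (- ((\sum_(u <- enum (nbrs S v)) entry w v u ^+ 2) / k)).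
have C0 : 0 <= C.
  by rewrite mulr_ge0 ?expR_ge0//; case: ifP => // _; rewrite mulr_ge0 ?powR_ge0 ?expR_ge0.
pose c ij := - (entry w v ij.1 * entry w v ij.2 / k).
have NS : {subset nbrs S v <= S :\ v}.
  move=> u; rewrite inE in_setD1 => /andP[-> Evu]; rewrite andbT.
  by apply: contraTneq Evu => ->; rewrite irrE.
transitivity (iter_integral (block_entries (S :\ v))
    (fun w' => (C%:E * (block_density delta (S :\ v) (fun ij => w' ij + c ij)%R)%:E)%E) w).
  apply: iter_integral_eq => w' ww'.
  have w'v i : entry w' v i = entry w v i.
    rewrite /entry ww'//; rewrite /opair; case: ifP => _;
    by rewrite mem_block_entries !in_setD1 eqxx ?andbF.
  rewrite (block_density_schur _ _ vS) -EFinM w'v kE /C; congr EFin.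
  case: ltP => // k0; last by rewrite !mul0r.
  have -> : schur v w' = (fun ij => w' ij + c ij).
    by apply/funext => ij; rewrite /schur /c !w'v kE.
  congr (_ * _).
  rewrite -mulrA -expRD -opprD; congr (_ * expR (- (_ + _))); congr (_ / _).
  rewrite big_enum (big_setID (nbrs S v)) /= [X in _ + X]big1 ?addr0.
    rewrite (finset.setIidPr _); last by apply/fintype.subsetP.
    by apply: eq_bigr => u _; rewrite w'v.
  move=> u; rewrite finset.in_setD => /andP[uN]; rewrite in_setD1 => /andP[uv _].
  by rewrite w'v (pivot_entry0 uN uv ww) expr0n.
rewrite iter_integralZ//; last first.
  move=> d T g mg; have := @mPhi (S :\ v) _ _ (fun x ij => g x ij + c ij); apply => ij.
  exact: measurable_funD.
rewrite (@iter_integral_translate _ _ _ (fun w => (block_density delta (S :\ v) w)%:E))//.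
rewrite muleA -EFinM -/C; congr (_ * _)%E.
(* The positions with both ends in [S :\ v], on which the density depends. The two starting points
   are to be compared at those that are frozen. *)
pose D : pred ('I_p * 'I_p) := [pred ij | [exists i in S :\ v, exists j in S :\ v, ij == opair i j]].
have DE i j : i \in S :\ v -> j \in S :\ v -> opair i j \in D.
  by move=> iS jS; apply/exists_inP; exists i => //; apply/exists_inP; exists j.
apply: (@iter_integral_agree _ _ D).
  move=> w1 w2 w12.
  have e12 i j : i \in S :\ v -> j \in S :\ v -> entry w1 i j = entry w2 i j.
    by move=> iS jS; apply: w12; exact: DE.
  have -> : block_density delta (S :\ v) w1 = block_density delta (S :\ v) w2 => //.
  rewrite /block_density.
  have -> : blockmx (S :\ v) w1 = blockmx (S :\ v) w2.
    apply/matrixP => i j; rewrite !mxE; case: ifP => // /andP[iS jS]; exact: e12.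
  by rewrite (eq_bigr (fun i => entry w2 i i))// => i iS; exact: e12.
move=> _ /exists_inP[i iS /exists_inP[j jS /eqP->]] nij.
have cE : c (opair i j) = - (entry w v i * entry w v j / k).
  by rewrite /c /opair; case: ifP => //= _; rewrite [X in X / _]mulrC.
rewrite cE ww ?notin_star// {1}/upd.
have [iv jv] : i != v /\ j != v by move: iS jS; rewrite !in_setD1 => /andP[-> _] /andP[-> _].
have -> : (opair i j == opair v v) = false.
  by apply/eqP => /opair_eq[[iv' _]|[iv' _]]; rewrite iv' eqxx in iv.
rewrite !pair_startE; case: eqVneq => [ijab|ijab].
  case: (opair_eq ijab) => -[-> ->] //.
  by rewrite [X in _ - X / _]mulrC.
rewrite add0r.
(* At a frozen position other than that of [a] and [b] the shift must vanish. If [i] and [j] were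
   both neighbours of [v], simpliciality would make them adjacent in the enlarged graph, so the
   position would be integrated over or be that of [a] and [b]. *)
have [iN|iN] := boolP (i \in nbrs S v); last first.
  by rewrite (pivot_entry0 iN iv ww) !mul0r oppr0.
have [jN|jN] := boolP (j \in nbrs S v); last first.
  by rewrite (pivot_entry0 jN jv ww) mulr0 mul0r oppr0.
have ij : i != j.
  apply: contraNneq nij => <-; rewrite opair_id mem_block_entries.
  by rewrite iS eqxx.
have : Ee i j.
  move: iN jN; rewrite !inE => /andP[iS' vi] /andP[jS' vj].
  by apply: simv => //; rewrite /Ee /add_edge ?vi ?vj.
rewrite /Ee /add_edge => /or3P[Eij|/andP[/eqP ia /eqP jb]|/andP[/eqP ib /eqP ja]].
- case/negP: nij; rewrite /opair; have [ltij|ltji|/val_inj eij] := ltngtP i j.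
  + by rewrite mem_block_entries iS jS ltij Eij orbT.
  + by rewrite mem_block_entries iS jS ltji symE Eij orbT.
  + by rewrite eij eqxx in ij.
- by rewrite ia jb eqxx in ijab.
- by rewrite ib ja opairC eqxx in ijab.
Qed.

Lemma offdiag_marginal_pivot s : offdiag_marginal S s =
  (\int[mu]_k ((if (0 < k)%R then k `^ delta * expR (- k) else 0)%:E *
    iter_integral star (fun w =>
      (expR (- ((\sum_(u <- enum (nbrs S v)) entry w v u ^+ 2) / k)))%:E *
      offdiag_marginal (S :\ v) (s - entry w v a * entry w v b / k))
     (upd (pair_start s) (opair v v) k)))%E.
Proof.
rewrite /offdiag_marginal (iter_integral_perm _ _ (block_entries_pivot vS))//.
rewrite [LHS]/= iter_integral_cat; apply: eq_integral => k _.
rewrite -iter_integralZ; last 3 first.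
- by rewrite lee_fin; case: ifP => // _; rewrite mulr_ge0 ?powR_ge0 ?expR_ge0.
- by move=> w; rewrite mule_ge0// ?offdiag_marginal_ge0// lee_fin expR_ge0.
- move=> d T g mg; apply: emeasurable_funM.
    exact: (coord_measurable_expR_sumsq v (enum (nbrs S v)) k mg).
  apply: (measurableT_comp (@measurable_offdiag_marginal (S :\ v))).
  apply: measurable_funB => //; apply: measurable_funM => //.
  by apply: measurable_funM; exact: measurable_entry.
rewrite -opair_id; apply: iter_integral_eq => w ww.
exact: offdiag_marginal_reduce.
Qed.

End pivot.
End elimination.

(** * Induction over the elimination of vertices *)

Section elimination_steps.
Variables (R : realType) (p : nat) (E : rel 'I_p) (a b : 'I_p) (delta : R).
Hypotheses (symE : symmetric E) (irrE : irreflexive E).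
Hypotheses (neq_ab : a != b) (nE_ab : ~~ E a b).
Notation mu := (@lebesgue_measure R).
Implicit Types (S : {set 'I_p}) (w : 'I_p * 'I_p -> R).
Notation marginal := (offdiag_marginal E a b delta).
Local Open Scope ereal_scope.

Section step.
Variables (S : {set 'I_p}) (v : 'I_p) (beta : R) (C : \bar R).
Hypotheses (vS : v \in S) (va : v != a) (vb : v != b).
Hypothesis simv : simplicial (add_edge E a b) S v.
Hypotheses (C0 : 0 <= C)
  (margS : forall s, marginal (S :\ v) s = C * offdiag_density beta s).

(** One of the entries of row [v] at [a] and [b] is frozen at 0, so [s] is not shifted and the
    Gaussian integrals come out as a constant. *)
Lemma offdiag_marginal_step_uncommon :
  ~~ ((a \in nbrs E S v) && (b \in nbrs E S v)) ->
  exists2 C', 0 <= C' & forall s, marginal S s = C' * offdiag_density beta s.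
Proof.
move=> nab; set l := enum (nbrs E S v).
pose g (k : R) := (if 0 < k then k `^ delta * expR (- k) * ((pi * k) `^ (2^-1)) ^+ size l else 0)%R.
have g0 k : 0 <= (g k)%:E.
  by rewrite lee_fin /g; case: ifP => // _; rewrite !mulr_ge0 ?exprn_ge0 ?powR_ge0 ?expR_ge0.
have mg : measurable_fun [set: R] (fun k => (g k)%:E) by rewrite /g; measurability.
exists ((\int[mu]_k (g k)%:E) * C) => [|s]; first by rewrite mule_ge0// integral_ge0.
rewrite (offdiag_marginal_pivot delta symE irrE vS va vb simv) -muleA.
have h0 : 0 <= C * offdiag_density beta s by rewrite mule_ge0// offdiag_density_ge0.
rewrite -ge0_integralZr//; apply: eq_integral => k _; rewrite /g.
case: ltP => k0; last by rewrite !mul0e.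
rewrite [in RHS]EFinM -[RHS]muleA; congr (_ * _).
transitivity (iter_integral [seq opair v u | u <- l]
    (fun w => (expR (- ((\sum_(u <- l) entry w v u ^+ 2) / k)))%:E *
       (C * offdiag_density beta s)) (upd (pair_start a b s) (opair v v) k)); last first.
  rewrite (@iter_integral_gauss _ _ v k l (fun=> C * offdiag_density beta s))//.
    exact: enum_uniq.
  by move=> d T f mf; exact: measurable_cst.
apply: iter_integral_eq => w ww; rewrite margS; congr (_ * (C * offdiag_density _ _)).
have [aN|aN] := boolP (a \in nbrs E S v).
  have bN : b \notin nbrs E S v by rewrite aN in nab.
  by rewrite (pivot_entry0 va vb bN _ ww) ?mulr0 ?mul0r ?subr0// eq_sym.
by rewrite (pivot_entry0 va vb aN _ ww) ?mul0r ?subr0// eq_sym.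
Qed.

(** The entries [y] and [z] of row [v] at [a] and [b] are taken outermost. The other neighbours
    contribute plain Gaussian factors, and the shift of [s] by y z / k raises the exponent by one
    half. *)
Lemma offdiag_marginal_step_common :
  a \in nbrs E S v -> b \in nbrs E S v ->
  exists2 C', 0 <= C' & forall s, marginal S s = C' * offdiag_density (beta + 2^-1) s.
Proof.
move=> aN bN; pose l := enum (nbrs E S v :\ a :\ b).
have [c c0 cE] := offdiag_density_mixing_scaled beta.
have perml : perm_eq (enum (nbrs E S v)) (a :: b :: l).
  apply: uniq_perm; first exact: enum_uniq.
    by rewrite !cons_uniq in_cons !mem_enum !in_setD1 !eqxx !andbF (negPf neq_ab) enum_uniq.
  move=> i; rewrite !in_cons !mem_enum !in_setD1.
  by have [->|ia] := eqVneq i a; have [ib|ib] := eqVneq i b; rewrite /= ?orbT//; subst.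
(* The total weight of the pivot; the last factor [k] comes from the scaled integral over [y] and
   [z]. *)
pose g (k : R) := (if 0 < k then k `^ delta * expR (- k) * (((pi * k) `^ (2^-1)) ^+ size l * k) else 0)%R.
have g0 k : 0 <= (g k)%:E.
  rewrite lee_fin /g; case: ltP => // k0.
  by rewrite !mulr_ge0 ?exprn_ge0 ?powR_ge0 ?expR_ge0 ?ltW.
have mg : measurable_fun [set: R] (fun k => (g k)%:E) by rewrite /g; measurability.
exists ((\int[mu]_k (g k)%:E) * (C * c)) => [|s]; first by rewrite !mule_ge0// integral_ge0.
rewrite (offdiag_marginal_pivot delta symE irrE vS va vb simv) -muleA.
have h0 : 0 <= C * c * offdiag_density (beta + 2^-1) s by rewrite !mule_ge0// offdiag_density_ge0.
rewrite -ge0_integralZr//; apply: eq_integral => k _; rewrite /g.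
case: ltP => k0; last by rewrite !mul0e.
rewrite [in RHS]EFinM -[RHS]muleA; congr (_ * _).
set w0 := upd _ _ _; set r := ((pi * k) `^ (2^-1))%R.
have r0 : (0 <= r ^+ size l)%R by rewrite exprn_ge0// powR_ge0.
pose q w := (expR (- ((entry w v a ^+ 2 + entry w v b ^+ 2) / k)))%:E *
  (C * offdiag_density beta (s - entry w v a * entry w v b / k)).
have q0 w : 0 <= q w.
  by rewrite !mule_ge0// ?offdiag_density_ge0// lee_fin expR_ge0.
have mq : coord_measurable q.
  move=> d T f mf; have mfe i : measurable_fun [set: T] (fun x => entry (f x) v i).
    exact: measurable_entry.
  apply: emeasurable_funM.
    apply/measurable_EFinP; apply: (measurableT_comp (@measurable_expR _)).
    apply: measurable_funN; apply: measurable_funM => //.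
    by apply: measurable_funD; exact: measurable_funX.
  apply: measurable_funeM.
  apply: (measurableT_comp (@measurable_offdiag_density _ beta)).
  by apply: measurable_funB => //; do 2!apply: measurable_funM => //.
pose F w := (expR (- ((\sum_(u <- l) entry w v u ^+ 2) / k)))%:E * q w.
have F0 w : 0 <= F w by rewrite mule_ge0// lee_fin expR_ge0.
have mF : coord_measurable F.
  move=> d T f mf; apply: emeasurable_funM; last exact: mq.
  exact: (coord_measurable_expR_sumsq v l k mf).
rewrite (_ : (fun w => _) = F); last first.
  apply/funext => w; rewrite margS /F /q [RHS]muleA -EFinM -expRD; congr ((expR _)%:E * _).
  by rewrite (perm_big _ perml) /= !big_cons; ring.
rewrite (iter_integral_perm F0 mF (perm_map _ perml)) /=.
pose G (y : R) (z : R) := (expR (- ((y ^+ 2 + z ^+ 2) / k)))%:E * offdiag_density beta (s - y * z / k).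
have G0 y z : 0 <= G y z by rewrite mule_ge0// ?offdiag_density_ge0// lee_fin expR_ge0.
have mG : measurable_fun [set: R * R] (fun x : R * R => G x.1 x.2).
  apply: emeasurable_funM; first by measurability.
  by apply: (measurableT_comp (@measurable_offdiag_density _ beta)); measurability.
have rC0 : 0 <= (r ^+ size l)%:E * C by rewrite mule_ge0// lee_fin.
have ql w u t : u \in l -> q (upd w (opair v u) t) = q w.
  rewrite mem_enum !in_setD1 => /and3P[ub ua _].
  by rewrite /q /entry /upd !(inj_eq (@opair_inj _ v)) ![_ == u]eq_sym (negPf ub) (negPf ua).
transitivity (\int[mu]_y ((r ^+ size l)%:E * C * \int[mu]_z G y z)).
  apply: eq_integral => y _; rewrite -[RHS]ge0_integralZl; first last.
  - exact: rC0.
  - by move=> z _; exact: G0.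
  - exact: (measurableT_comp mG (pair1_measurable _)).
  - exact: measurableT.
  apply: eq_integral => z _.
  rewrite (iter_integral_gauss _ k0 (enum_uniq _) q0 mq ql).
  rewrite /q /entry /upd !(inj_eq (@opair_inj _ v)) !eqxx (negPf neq_ab).
  by rewrite -muleA; congr (_ * _); rewrite muleCA.
rewrite ge0_integralZl; first last.
- exact: rC0.
- by move=> y _; apply: integral_ge0 => z _; exact: G0.
- exact: (@measurable_fun_fubini_tonelli_F _ _ _ _ _ mu (fun x => G x.1 x.2)).
- exact: measurableT.
rewrite cE// EFinM -!muleA; congr (_ * _).
by rewrite [LHS]muleCA; congr (_ * _).
Qed.

End step.

(** The pivots at [a] and [b] are [k] and m - s^2 / k. Translating [m] separates the two
    integrals. *)
Lemma offdiag_marginal_base : exists2 C, 0 <= C &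
  forall s, marginal [set a; b]%SET s = C * offdiag_density delta s.
Proof.
have aS : a \in [set a; b]%SET by rewrite finset.set21.
have Sb : [set a; b]%SET :\ a = [set b]%SET.
  apply/setP => i; rewrite !inE; have [->|] := eqVneq i a => //=.
  by rewrite (negPf neq_ab).
have bS : b \in [set b]%SET by rewrite finset.set11.
have S0 : [set b]%SET :\ b = finset.set0.
  by apply/setP => i; rewrite !inE; case: eqP.
have Na : nbrs E [set a; b]%SET a = finset.set0.
  apply/setP => i; rewrite !inE; have [->|ia] := eqVneq i a; first by rewrite irrE andbF.
  by have [->|] := eqVneq i b; rewrite //= (negPf nE_ab).
have Nb : nbrs E [set b]%SET b = finset.set0.
  by apply/setP => i; rewrite !inE; have [->|] := eqVneq i b; rewrite //= irrE.
have permS : perm_eq (block_entries E [set a; b]%SET) [:: (a, a); (b, b)].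
  apply: perm_trans (block_entries_pivot symE irrE aS) _.
  rewrite Na Sb enum_set0 /= perm_cons.
  apply: perm_trans (block_entries_pivot symE irrE bS) _.
  rewrite Nb S0 enum_set0 /= perm_cons.
  suff -> : block_entries E finset.set0 = [::] by [].
  apply/eqP; rewrite -size_eq0 -all_pred0; apply/allP => -[i j].
  by rewrite mem_block_entries inE.
pose g (k : R) := (if 0 < k then k `^ delta * expR (- k) else 0)%R.
have g0 k : 0 <= (g k)%:E.
  by rewrite lee_fin /g; case: ifP => // _; rewrite mulr_ge0 ?powR_ge0 ?expR_ge0.
have mg : measurable_fun [set: R] (fun k => (g k)%:E) by rewrite /g; measurability.
exists (\int[mu]_k (g k)%:E) => [|s]; first exact: integral_ge0.
rewrite /offdiag_marginal (iter_integral_perm _ _ permS); last 2 first.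
- by move=> w; rewrite lee_fin block_density_ge0.
- exact: coord_measurable_block_density.
rewrite muleC /offdiag_density -ge0_integralZr//; last 3 first.
- by measurability.
- by move=> k _; rewrite lee_fin; case: ifP => // _; rewrite !mulr_ge0 ?powR_ge0 ?expR_ge0.
- exact: integral_ge0.
apply: eq_integral => k _; rewrite [LHS]/=.
have aa_bb : ((a, a) == (b, b)) = false by rewrite xpair_eqE (negPf neq_ab).
have aa_ab : ((a, a) == opair a b) = false.
  by rewrite -opair_id (inj_eq (@opair_inj _ a)) (negPf neq_ab).
have bb_ab : ((b, b) == opair a b) = false.
  by rewrite -opair_id [opair a b]opairC (inj_eq (@opair_inj _ b)) eq_sym (negPf neq_ab).
(* The constant is rewritten as the integral over [m] of the weight at the second pivot. *)
rewrite -(@ge0_integral_translate _ _ (- (s ^+ 2 / k))%R)//.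
rewrite -ge0_integralZl//; last 2 first.
- by apply: (measurableT_comp mg); exact: measurable_funD.
- by rewrite lee_fin; case: ifP => // _; rewrite !mulr_ge0 ?powR_ge0 ?expR_ge0.
apply: eq_integral => m _; rewrite -EFinM; congr EFin.
set w := upd _ _ _.
have waa : entry w a a = k by rewrite /entry opair_id /w /upd aa_bb eqxx.
have wab : entry w a b = s by rewrite /entry /w /pair_start /upd [_ == (b, b)]eq_sym bb_ab [_ == (a, a)]eq_sym aa_ab eqxx.
have wbb : entry w b b = m by rewrite /entry opair_id /w /upd eqxx.
rewrite (block_density_schur _ _ aS) Sb waa big_set1 wab.
case: ltP => k0; last by rewrite mul0r.
rewrite (block_density_schur _ _ bS) S0 big_set0 entry_schur waa wbb wab mul0r addr0 -expr2.
rewrite opprD expRD mulrA; congr (_ * _)%R.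
rewrite /g; case: ifP => // _.
rewrite /block_density blockmx0 asboolT; last exact: posdefmx1.
by rewrite det1 powR1 big_set0 oppr0 expR0 !mulr1.
Qed.

(** As long as [S] is larger than the clique formed by [a] and [b], it has a simplicial vertex
    outside that clique. Each eliminated common neighbour of [a] and [b] adds one half to the
    exponent. *)
Lemma offdiag_marginalE (S : {set 'I_p}) : chordal (add_edge E a b) ->
  [set a; b]%SET \subset S ->
  exists2 C, 0 <= C & forall s, marginal S s =
    C * offdiag_density (delta + #|[set u in S | E u a && E u b]%SET|%:R / 2) s.
Proof.
move=> chE; have [n] := ubnP #|S|; elim: n S => // n IH S Sn abS.
have irrEe : irreflexive (add_edge E a b).
  move=> i; rewrite /add_edge irrE /=; apply/orP.
  by case=> /andP[/eqP-> /eqP ab']; move: neq_ab; rewrite ab' eqxx.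
have symEe : symmetric (add_edge E a b).
  by move=> i j; rewrite /add_edge symE; congr (_ || _); rewrite orbC [X in X || _]andbC [X in _ || X]andbC.
have [<-|abS'] := eqVneq [set a; b]%SET S.
  have -> : [set u in [set a; b]%SET | E u a && E u b]%SET = finset.set0.
    apply/setP => i; rewrite !inE; have [->|ia] := eqVneq i a; first by rewrite irrE.
    by have [->|] := eqVneq i b; rewrite ?irrE ?andbF.
  by rewrite cards0 mul0r addr0; exact: offdiag_marginal_base.
have [||v] := @exists_simplicial _ _ symEe irrEe S [set a; b]%SET chE.
- by rewrite finset.properEneq abS' abS.
- move=> i j; rewrite !inE /add_edge => /orP[]/eqP-> /orP[]/eqP->; rewrite ?eqxx ?orbT//.
rewrite finset.in_setD !inE negb_or -andbA => /and3P[va vb vS] simv.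
have abSv : [set a; b]%SET \subset S :\ v.
  by rewrite finset.subsetD1 abS !inE negb_or [v == a]eq_sym ![_ == v]eq_sym va vb.
have [||C C0 CE] := IH (S :\ v) => //.
  by rewrite -ltnS (leq_trans _ Sn)// ltnS [X in (_ < X)%N](cardsD1 v) vS.
have aS : a \in S by apply: (fintype.subsetP abS); rewrite finset.set21.
have bS : b \in S by apply: (fintype.subsetP abS); rewrite finset.set22.
have cardS : #|[set u in S | E u a && E u b]%SET| =
    ((E v a && E v b) + #|[set u in S :\ v | E u a && E u b]%SET|)%N.
  rewrite (cardsD1 v) !inE vS; congr (_ + #|pred_of_set _|)%N.
  by apply/setP => i; rewrite !inE -!andbA.
have [/andP[Eva Evb]|nE] := boolP (E v a && E v b).
  have [||C' C'0 C'E] := offdiag_marginal_step_common vS va vb simv C0 CE.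
  - by rewrite inE aS.
  - by rewrite inE bS.
  have exponentE : (delta + #|[set u in S :\ v | E u a && E u b]%SET|%:R / 2 + 2^-1 =
      delta + #|[set u in S | E u a && E u b]%SET|%:R / 2)%R.
    by rewrite cardS Eva Evb natrD /=; field.
  by exists C' => [|s]; [exact: C'0|rewrite C'E exponentE].
have [|C' C'0 C'E] := offdiag_marginal_step_uncommon vS va vb simv C0 CE.
  by rewrite !inE aS bS.
by exists C' => [|s]; [exact: C'0|rewrite C'E cardS (negPf nE)].
Qed.

End elimination_steps.

(** * Convergence and positivity of the Gamma integral *)

Section gamma.
Variable R : realType.
Notation mu := (@lebesgue_measure R).
Local Open Scope ereal_scope.

Definition gamma_fun (x k : R) : R := (if 0 < k then k `^ (x - 1) * expR (- k) else 0)%R.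

Lemma gamma_fun_ge0 x k : (0 <= gamma_fun x k)%R.
Proof. by rewrite /gamma_fun; case: ifP => // _; rewrite mulr_ge0 ?powR_ge0 ?expR_ge0. Qed.

Lemma measurable_gamma_fun x : measurable_fun [set: R] (EFin \o gamma_fun x).
Proof. by rewrite /gamma_fun /comp; measurability. Qed.

(** The interval is exhausted by the compact intervals [[e n, 1]], on which k^x / x is a
    primitive. *)
Lemma integral_powR_le (x : R) : (0 < x)%R ->
  \int[mu]_(k in `]0%R, 1%R]) (k `^ (x - 1))%:E <= (x^-1)%:E.
Proof.
move=> x0; have xN0 : x != 0%R by rewrite gt_eqF.
have mf : measurable_fun [set: R] (fun k : R => (k `^ (x - 1))%:E) by measurability.
(* Starting at 1/2 keeps every interval nondegenerate, as the fundamental theorem asks. *)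
pose e n : R := (n.+2%:R^-1)%R.
have e0 n : (0 < e n)%R by rewrite invr_gt0 ltr0n.
have e1 n : (e n < 1)%R by rewrite invf_lt1 ?ltr0n// ltr1n.
have eE : `]0%R, 1%R]%classic = \bigcup_n `[e n, 1%R]%classic :> set R.
  apply/seteqP; split=> [k|k [n _]] /=; rewrite !in_itv /= => /andP[k0 k1].
    exists (Num.truncn k^-1)%N => //=; rewrite in_itv /= k1 andbT.
    rewrite /e -[leRHS]invrK lef_pV2 ?posrE ?invr_gt0 ?ltr0n//.
    by rewrite ltW// (lt_trans (truncnS_gt _))// ltr_nat.
  by rewrite (lt_le_trans (e0 n) k0).
rewrite eE; apply: (cvge_le _ (ge0_nondecreasing_set_cvg_integral _ _ _ _)) => //.
- apply: nearW => n; rewrite (@continuous_FTC2 _ _ (fun k => x^-1 * k `^ x)%R)//.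
  + rewrite powR1 mulr1 -EFinB lee_fin gerBl mulr_ge0 ?powR_ge0// invr_ge0 ltW//.
  + apply: derivable_within_continuous => k; rewrite in_itv /= => /andP[ek _].
    by apply: derivable_powR; rewrite in_itv /= andbT (lt_le_trans (e0 n)).
  + have dF k : (0 < k)%R -> derivable (fun k : R => x^-1 * k `^ x)%R k 1.
      move=> k0; apply: derivableM => //.
      by apply: derivable_powR; rewrite in_itv /= andbT.
    have cF k : (0 < k)%R -> {for k, continuous (fun k : R => x^-1 * k `^ x)%R}.
      by move=> k0; apply: differentiable_continuous; apply/derivable1_diffP; exact: dF.
    split.
    * move=> k; rewrite in_itv /= => /andP[ek _]; apply: dF; exact: lt_trans ek.
    * by apply: cvg_at_right_filter; exact: cF.
    * by apply: cvg_at_left_filter; apply: cF.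
  + move=> k; rewrite in_itv /= => /andP[ek _]; have k0 := lt_trans (e0 n) ek.
    rewrite derive1E deriveM//; last by apply: derivable_powR; rewrite in_itv /= andbT.
    have [_ ->] := is_derive1_powR x k0; rewrite derive_cst scaler0 addr0 /GRing.scale /= mulrA mulVf ?mul1r//.
- move=> m n mn; rewrite subsetEset => k /=; rewrite !in_itv /= => /andP[ek ->].
  by rewrite andbT (le_trans _ ek)// /e lef_pV2 ?posrE ?ltr0n// ler_nat.
- by move=> n; apply: measurable_funTS.
- by move=> n k _; rewrite lee_fin powR_ge0.
Qed.

(** One term of the exponential series at k / 2, of degree above [y], suffices. *)
Lemma powR_le_expR (y : R) : exists2 c : R, (0 <= c)%R &
  forall k, (1 <= k)%R -> (k `^ y <= c * expR (k / 2))%R.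
Proof.
pose n := (Num.truncn y).+1.
exists (n.+1`!%:R * 2 ^+ n.+1)%R => [|k k1]; first by rewrite mulr_ge0 ?exprn_ge0.
have k0 : (0 <= k)%R by exact: le_trans k1.
have kn : (k `^ y <= k ^+ n.+1)%R.
  rewrite -powR_mulrn// ler_powR// ltW// (lt_trans (truncnS_gt _))// ltr_nat //.
apply: (le_trans kn).
have := @expR_ge1Dxn R (k / 2) n (divr_ge0 k0 (ler0n _ _)).
have f0 : (0 < n.+1`!%:R :> R)%R by rewrite ltr0n fact_gt0.
move=> /(le_trans _)-/(_ ((k / 2) ^+ n.+1 / n.+1`!%:R)%R) h.
have {h} : ((k / 2) ^+ n.+1 / n.+1`!%:R <= expR (k / 2))%R.
  by apply: h; rewrite lerDr.
rewrite ler_pdivrMr// expr_div_n ler_pdivrMr ?exprn_gt0// => /le_trans; apply.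
by rewrite -mulrA mulrC.
Qed.

(** [Gamma] is a real-valued integral, which would be 0 if the extended one were infinite;
    finiteness is what identifies the two. *)
Lemma integral_gamma_fun_fin (x : R) : (0 < x)%R ->
  \int[mu]_k (gamma_fun x k)%:E < +oo.
Proof.
move=> x0; have [c c0 cE] := powR_le_expR (x - 1).
(* [f1] dominates up to 1. Beyond, [f2] equals c exp(- k / 2), written as a multiple of an
   exponential density whose mass is known. *)
pose f1 (k : R) := (((fun k => k `^ (x - 1)) \_ `]0%R, 1%R]) k)%:E.
pose f2 (k : R) := (2 * c)%:E * (exponential_pdf 2^-1 k)%:E.
have h0 : (0 <= 2^-1 :> R)%R by rewrite invr_ge0.
have f10 k : 0 <= f1 k.
  by rewrite lee_fin; apply: restrict_ge0 => t _; exact: powR_ge0.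
have f20 k : 0 <= f2 k.
  by rewrite mule_ge0// lee_fin ?mulr_ge0// exponential_pdf_ge0.
have mf1 : measurable_fun [set: R] f1.
  apply/measurable_EFinP/measurable_restrict => //; apply: measurable_funTS.
  exact: measurable_powR.
have mf2 : measurable_fun [set: R] f2.
  apply: measurable_funeM; apply/measurable_EFinP; exact: measurable_exponential_pdf.
apply: (@le_lt_trans _ _ (\int[mu]_k (f1 k + f2 k))).
  apply: ge0_le_integral => //.
  - by move=> k _; rewrite lee_fin gamma_fun_ge0.
  - exact: measurable_gamma_fun.
  - exact: emeasurable_funD.
  move=> k _; rewrite /gamma_fun; case: ltP => k0; last by rewrite adde_ge0.
  have [k1|k1] := leP k 1%R.
    have f1E : f1 k = (k `^ (x - 1))%:E.
      by rewrite /f1 patchE ifT// inE /= in_itv /= k0 k1.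
    rewrite -[leLHS]adde0 leeD// f1E.
    by rewrite lee_fin ler_piMr ?powR_ge0// expR_le1 oppr_le0 ltW.
  have f2E : f2 k = (c * expR (- (k / 2)))%:E.
    rewrite /f2 exponential_pdfE ?ltW// -EFinM; congr EFin.
    by rewrite mulNr [(2^-1 * k)%R]mulrC; field.
  rewrite -[leLHS]add0e leeD// f2E lee_fin.
  apply: (le_trans (ler_wpM2r (expR_ge0 _) (cE _ (ltW k1)))).
  rewrite -mulrA -expRD (_ : k / 2 - k = - (k / 2))%R//; lra.
rewrite ge0_integralD//; apply: lte_add_pinfty.
  apply: le_lt_trans (ltry x^-1%R); apply: le_trans (integral_powR_le x0).
  rewrite [leRHS]integral_mkcond le_eqVlt; apply/orP; left; apply/eqP.
  by apply: eq_integral => k _; rewrite /f1 !patchE; case: ifP.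
rewrite ge0_integralZl//.
- by rewrite integral_exponential_pdf// mule1 ltry.
- by apply/measurable_EFinP; exact: measurable_exponential_pdf.
- by move=> k _; rewrite lee_fin exponential_pdf_ge0.
- by rewrite lee_fin mulr_ge0.
Qed.

Lemma integral_gamma_fun (x : R) : (0 < x)%R ->
  \int[mu]_k (gamma_fun x k)%:E = (Gamma x)%:E.
Proof.
move=> x0; have fin := integral_gamma_fun_fin x0.
have ge0 : 0 <= \int[mu]_k (gamma_fun x k)%:E.
  by apply: integral_ge0 => k _; rewrite lee_fin gamma_fun_ge0.
rewrite -[LHS]fineK ?ge0_fin_numE//; congr EFin.
rewrite /Gamma /Rintegral [in RHS]integral_mkcond; congr fine.
apply: eq_integral => k _; rewrite patchE /gamma_fun.
by rewrite mem_setE in_itv /= andbT; case: ifP.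
Qed.

(** On the interval from 1 to 2 the integrand is at least exp(-2) / 2, because x - 1 is at least
    -1. *)
Lemma Gamma_gt0 (x : R) : (0 < x)%R -> (0 < Gamma x)%R.
Proof.
move=> x0; rewrite -lte_fin -integral_gamma_fun//.
apply: (@lt_le_trans _ _ (\int[mu]_(k in `[1%R, 2%R]) (cst (2^-1 * expR (- 2))%:E) k)).
  rewrite integral_cst//= lebesgue_measure_itv /= lte_fin ltr1n -EFinB.
  by rewrite mule_gt0// lte_fin ?mulr_gt0 ?expR_gt0//; lra.
apply: (@le_trans _ _ (\int[mu]_(k in `[1%R, 2%R]) (gamma_fun x k)%:E)).
  apply: ge0_le_integral => //.
  - by move=> k _; rewrite lee_fin mulr_ge0 ?expR_ge0.
  - by apply: measurable_funTS; exact: measurable_gamma_fun.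
  move=> k /=; rewrite in_itv /= => /andP[k1 k2].
  have k0 : (0 < k)%R by exact: lt_le_trans k1.
  rewrite lee_fin /gamma_fun k0 ler_pM ?expR_ge0//; last by rewrite ler_expR lerN2.
  apply: (@le_trans _ _ (k `^ (-1)))%R; last by rewrite ler_powR//; lra.
  rewrite powR_inv1; last exact: ltW.
  by rewrite lef_pV2 ?posrE.
apply: (@ge0_subset_integral _ (measurableTypeR R) R mu) => //.
  exact: measurable_gamma_fun.
by move=> k _; rewrite lee_fin gamma_fun_ge0.
Qed.

End gamma.

(** * Wishart integrals as marginals, the triangle count and the conclusion *)

Section wishart.
Variables (R : realType) (p : nat).
Notation mu := (@lebesgue_measure R).

(** The default 0 of [nth] at non-edges is the value 0 of the starting point, so membership in the
    cone reduces to positive definiteness. *)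
Lemma wishart_integralE (E : rel 'I_p) (delta : R) : symmetric E ->
  wishart_integral E delta 1%:M =
  iter_integral (free_entries E) (fun w => (block_density delta [set: 'I_p]%SET w)%:E)
    (fun=> 0).
Proof.
move=> symE; rewrite -integral_lebesgue_tuple; last 3 first.
- by rewrite filter_uniq// enum_uniq.
- by move=> w; rewrite lee_fin block_density_ge0.
- exact: coord_measurable_block_density.
rewrite /wishart_integral [LHS]integral_mkcond; apply: eq_integral => k _.
set w := assign _ _ _.
have kw : mx_of_entries k = blockmx [set: 'I_p]%SET w.
  apply/matrixP => i j; rewrite !mxE !finset.in_setT /= /entry /opair /w /assign.
  case: ifPn => ij; case: ifPn => // nij; rewrite nth_default//.
    by rewrite size_tuple leqNgt index_mem.
  by rewrite size_tuple leqNgt index_mem.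
have posE : posdef_cone E (mx_of_entries k) <-> posdefmx (blockmx [set: 'I_p]%SET w).
  rewrite -kw; split=> [[]//|pw]; split=> // i j ij nE; rewrite mxE nth_default//.
  rewrite size_tuple leqNgt index_mem mem_filter.
  case: (leqP i j) => ij' /=; first by rewrite (negPf ij) (negPf nE) andbF.
  by rewrite eq_sym (negPf ij) symE (negPf nE) andbF.
rewrite patchE /block_density; case: asboolP => pw.
  rewrite ifT; last by rewrite inE; apply/posE.
  rewrite kw mulmx1; congr (_ * expR (- _))%:E.
  by apply: eq_big => i; rewrite ?finset.in_setT// mxE !finset.in_setT.
by rewrite ifF//; apply/negP; rewrite inE => /posE.
Qed.

(** A triangle through the added edge is determined by its third vertex, a common neighbour of [a]
    and [b]. *)
Lemma card_triangles_through (E : rel 'I_p) (a b : 'I_p) :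
  symmetric E -> irreflexive E -> a != b ->
  #|triangles_through (add_edge E a b) a b| = #|[set v | E v a && E v b]%SET|.
Proof.
move=> symE irrE ab.
have neq v c : E v c -> v != c by apply: contraTneq => ->; rewrite irrE.
have -> : triangles_through (add_edge E a b) a b =
    [set [set a; b; v] | v in [set v | E v a && E v b]%SET]%SET.
  apply/setP => T; rewrite finset.inE; apply/idP/imsetP => [/and4P[T3 aT bT eT]|].
    have /cards1P[v TvE] : #|T :\ a :\ b| == 1%N.
      move: T3; rewrite (cardsD1 a) aT (cardsD1 b (T :\ a)) finset.in_setD1 bT.
      by rewrite [b == a]eq_sym (negPf ab).
    have := finset.set11 v; rewrite -TvE !finset.in_setD1 => /and3P[vb va vT].
    have Ev c : c \in T -> v != c -> add_edge E a b v c.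
      by move=> cT; move: eT => /forall_inP/(_ v vT)/forall_inP/(_ c cT)/implyP.
    exists v.
      (* As [v] is neither [a] nor [b], its edges in the enlarged graph are edges of [E]. *)
      have := Ev a aT va; have := Ev b bT vb; rewrite finset.inE /add_edge.
      by rewrite (negPf va) (negPf vb) !orbF => -> ->.
    apply/setP => c; move: (congr1 (fun A : {set 'I_p} => c \in A) TvE).
    rewrite !finset.in_setD1 finset.in_set1 => cE; rewrite !finset.inE -cE.
    have [->|ca] := eqVneq c a; first by rewrite aT.
    by have [->|cb] := eqVneq c b; rewrite ?bT.
  move=> [v]; rewrite finset.inE => /andP[va vb] ->.
  have vaN := neq _ _ va; have vbN := neq _ _ vb.
  apply/and4P; split; rewrite ?finset.inE ?eqxx ?orbT//.
    rewrite finset.setUC cardsU1 !finset.inE (negPf vaN) (negPf vbN).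
    by rewrite cards2 ab.
  have [av bv] : E a v /\ E b v by rewrite ![E _ v]symE.
  apply/forall_inP => x xT; apply/forall_inP => y yT; apply/implyP.
  move: xT yT; rewrite !finset.inE /add_edge => /orP[/orP[]|] /eqP-> /orP[/orP[]|] /eqP->;
    by rewrite ?va ?vb ?av ?bv ?eqxx ?orbT.
rewrite card_in_imset// => v u; rewrite !finset.inE => /andP[va vb] _ /setP/(_ v).
rewrite !finset.inE eqxx orbT (negPf (neq _ _ va)) (negPf (neq _ _ vb)) /=.
by move=> /esym/eqP.
Qed.

(** Integrating over [s] first gives (pi k)^(1/2), which leaves Euler's integral with k^(beta +
    1/2). *)
Lemma integral_offdiag_density (beta : R) : -1 < beta ->
  (\int[mu]_s offdiag_density beta s = (pi `^ (2^-1) * Gamma (beta + 3 / 2))%:E)%E.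
Proof.
move=> b1; rewrite (@fubini_tonelli _ _ _ _ _ mu mu (fun x => (if (0 < x.2)%R then
  x.2 `^ beta * expR (- x.2) * expR (- (x.1 ^+ 2 / x.2)) else 0)%:E))/=; last 2 first.
- exact: measurable_offdiag_integrand.
- by move=> x; rewrite lee_fin; case: ifP => // _; rewrite !mulr_ge0 ?powR_ge0 ?expR_ge0.
transitivity (\int[mu]_k ((pi `^ (2^-1))%:E * (gamma_fun (beta + 3 / 2) k)%:E))%E.
  apply: eq_integral => k _; rewrite /gamma_fun; case: ltP => k0; last first.
    by rewrite integral0_eq// mule0.
  under eq_integral do rewrite EFinM.
  rewrite ge0_integralZl//; last 2 first.
  - by measurability.
  - by rewrite lee_fin mulr_ge0 ?powR_ge0 ?expR_ge0.
  rewrite integral_gauss_scaled// -!EFinM; congr EFin.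
  rewrite powRM ?pi_ge0 ?ltW// (_ : beta + 3 / 2 - 1 = beta + 2^-1); last by field.
  by rewrite powRD ?(gt_eqF k0) ?implybT//; ring.
rewrite ge0_integralZl; first last.
- by rewrite lee_fin powR_ge0.
- by move=> k _; rewrite lee_fin gamma_fun_ge0.
- exact: measurable_gamma_fun.
- exact: measurableT.
by rewrite integral_gamma_fun ?EFinM//; lra.
Qed.

Lemma offdiag_density0 (beta : R) : -1 < beta ->
  offdiag_density beta 0 = (Gamma (beta + 1))%:E.
Proof.
move=> b1; rewrite -integral_gamma_fun; last by lra.
by apply: eq_integral => k _; rewrite /gamma_fun addrK expr0n mul0r oppr0 expR0 mulr1.
Qed.

End wishart.

(** Makes the entry of the added edge the outermost variable, in the role of [s]. *)
Lemma free_entries_add_edge (p : nat) (E : rel 'I_p) (a b : 'I_p) :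
  symmetric E -> a != b -> ~~ E a b ->
  perm_eq (free_entries (add_edge E a b)) (opair a b :: free_entries E).
Proof.
move=> symE ab nE; have mem_free F i j : ((i, j) \in free_entries F) =
    (i == j) || ((i < j)%N && F i j) by rewrite mem_filter mem_enum andbT.
wlog lt_ab : a b ab nE / (a < b)%N.
  move=> wlog_ab; have [lt_ab|lt_ba|/val_inj eq_ab] := ltngtP a b.
  - exact: wlog_ab.
  - have -> : free_entries (add_edge E a b) = free_entries (add_edge E b a).
      apply: eq_filter => ij; rewrite /add_edge; congr (_ || (_ && (_ || _))).
      exact: orbC.
    by rewrite opairC; apply: wlog_ab; rewrite // 1?eq_sym// symE.
  - by rewrite eq_ab eqxx in ab.
have -> : opair a b = (a, b) by rewrite /opair ltnW.
apply: uniq_perm.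
- by rewrite filter_uniq// enum_uniq.
- by rewrite cons_uniq filter_uniq ?enum_uniq// andbT mem_free (negPf ab) (negPf nE) andbF.
move=> [i j]; rewrite in_cons !mem_free /add_edge xpair_eqE.
have ltN : ((i == b) && (j == a) && (i < j)%N) = false.
  by apply/negP => /andP[/andP[/eqP-> /eqP->]]; rewrite ltnNge ltnW.
have ltT : (i == a) && (j == b) -> (i < j)%N by move=> /andP[/eqP-> /eqP->].
move: ltN ltT; case: (_ && (j == a)); case: (_ && (j == b)); case: (i < j)%N => //=.
all: rewrite ?orbT ?orbF//; by [move=> _ /(_ isT)|].
Qed.

Theorem theorem2p5 (R : realType) (p : nat) (E : rel 'I_p)
    (symE : symmetric E) (irrE : irreflexive E)
    (fillE : min_fill_in_one E)
    (delta : R) (delta_gt : -1 < delta)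
    (a b : 'I_p) (neq_ab : a != b) (nE_ab : ~~ E a b)
    (chordal_Ee : chordal (add_edge E a b))
    (d : nat) (dE : d = #|triangles_through (add_edge E a b) a b|) :
  wishart_integral E delta 1%:M =
    ((pi `^ (- 2^-1) *
      (Gamma (delta + 2^-1 * (d%:R + 2)) / Gamma (delta + 2^-1 * (d%:R + 3))))%:E
     * wishart_integral (add_edge E a b) delta 1%:M)%E.
Proof.
have symEe : symmetric (add_edge E a b).
  move=> i j; rewrite /add_edge symE; congr (_ || _).
  by rewrite orbC; congr (_ || _); rewrite andbC.
have [C C0 CE] := offdiag_marginalE delta symE irrE neq_ab nE_ab chordal_Ee
  (finset.subsetT [set a; b]%SET).
have entriesT : block_entries E [set: 'I_p]%SET = free_entries E.
  by apply/all_filterP/allP => ij _; rewrite !finset.in_setT.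
(* For [s = 0] the starting point is the zero function. *)
have -> : wishart_integral E delta 1%:M = offdiag_marginal E a b delta [set: 'I_p]%SET 0.
  rewrite wishart_integralE// /offdiag_marginal entriesT; congr (iter_integral _ _ _).
  by apply/funext => ij; rewrite /pair_start /upd; case: eqP.
have -> : wishart_integral (add_edge E a b) delta 1%:M =
    (\int[lebesgue_measure]_s offdiag_marginal E a b delta [set: 'I_p]%SET s)%E.
  rewrite wishart_integralE//.
  rewrite (iter_integral_perm _ _ (free_entries_add_edge symE neq_ab nE_ab)).
  - by rewrite /offdiag_marginal entriesT.
  - by move=> w; rewrite lee_fin block_density_ge0.
  - exact: coord_measurable_block_density.
have cardT : #|[set u in [set: 'I_p]%SET | E u a && E u b]%SET| = d.
  rewrite dE card_triangles_through//; apply: eq_card => u.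
  by rewrite !finset.inE.
rewrite cardT in CE; set beta := delta + d%:R / 2 in CE.
have d0 : 0 <= d%:R / 2 :> R by rewrite divr_ge0.
have beta1 : -1 < beta by rewrite /beta; lra.
rewrite CE offdiag_density0//.
under eq_integral do rewrite CE.
rewrite ge0_integralZl; first last.
- exact: C0.
- by move=> s _; exact: offdiag_density_ge0.
- exact: measurable_offdiag_density.
- exact: measurableT.
(* [C] is a common factor of the two sides and is removed by congruence, not by division. An
   identity between real numbers remains. *)
rewrite integral_offdiag_density// muleCA; congr (C * _)%E; rewrite -EFinM; congr EFin.
have -> : delta + 2^-1 * (d%:R + 2) = beta + 1 by rewrite /beta; field.
have -> : delta + 2^-1 * (d%:R + 3) = beta + 3 / 2 by rewrite /beta; field.
have G0 : Gamma (beta + 3 / 2) != 0 by rewrite gt_eqF// Gamma_gt0//; lra.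
have pi0 : pi `^ 2^-1 != 0 :> R by rewrite gt_eqF// powR_gt0// pi_gt0.
by rewrite powRN; field; rewrite pi0 G0.
Qed.
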